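(* Let $\Phi$ be a symmetric norming function and $\mathfrak{I}=\mathfrak{S}_{\Phi}$. Let $a$ be a compact normal operator on $\mathcal{H}$. Then the quotient topology on $\mathcal{U}_{\mathfrak{I}}(a)=\{uau^*:u\in\mathcal{U}_{\mathfrak{I}}\}$ coincides with the topology inherited from $a+\mathfrak{I}$ if and only if $\operatorname{rank}(a)<\infty$.
   Context: $\mathcal{H}$ is an infinite dimensional separable Hilbert space. Let $\hat c$ be the real vector space of real sequences with finitely many nonzero terms. A symmetric norming function is a norm $\Phi:\hat c\to\mathbb{R}$ with $\Phi(1,0,0,\dots)=1$ and $\Phi(a_1,\dots,a_n,0,\dots)=\Phi(|a_{j_1}|,\dots,|a_{j_n}|,0,\dots)$ for every permutation $j_1,\dots,j_n$ of $1,\dots,n$, $n\geq 1$. For a compact operator $x$ with singular values $s_1(x)\ge s_2(x)\ge\cdots$, put $\|x\|_\Phi=\sup_{k\geq 1}\Phi(s_1(x),\dots,s_k(x),0,\dots)\in[0,\infty]$. Then $\mathfrak{S}_\Phi=\{x\text{ compact}:\|x\|_\Phi<\infty\}$ is a Banach space and a two-sided ideal of the bounded operators; write $\mathfrak{I}=\mathfrak{S}_\Phi$ and $\|\cdot\|_{\mathfrak{I}}=\|\cdot\|_\Phi$. $\mathcal{U}_{\mathfrak{I}}=\{u\text{ unitary on }\mathcal{H}:u-1\in\mathfrak{I}\}$ is a topological group with the metric $\|u_1-u_2\|_{\mathfrak{I}}$. For $u\in\mathcal{U}_{\mathfrak{I}}$ one has $uau^*\in a+\mathfrak{I}$; the affine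 space $a+\mathfrak{I}$ has the topology given by the metric $\|x-y\|_{\mathfrak{I}}$. The quotient topology on $\mathcal{U}_{\mathfrak{I}}(a)$ comes from the identification $\mathcal{U}_{\mathfrak{I}}(a)\simeq\mathcal{U}_{\mathfrak{I}}/\{u\in\mathcal{U}_{\mathfrak{I}}:ua=au\}$. *)

(* Defs.v *)
From HB Require Import structures.
From mathcomp Require Import all_boot all_order perm all_algebra sesquilinear.
From mathcomp Require Import all_classical all_reals all_analysis.
From mathcomp.real_closed Require Export complex.

Set Implicit Arguments.
Unset Strict Implicit.
Unset Printing Implicit Defensive.

Import Order.TTheory GRing.Theory Num.Theory numFieldNormedType.Exports.

Local Open Scope classical_set_scope.
Local Open Scope ring_scope.
Local Open Scope complex_scope.

Section FiniteDimension.
Context (K : fieldType) (V : lmodType K).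

Definition finite_dim (E : set V) :=
  exists m (e : 'I_m -> V), forall v, E v ->
    exists c : 'I_m -> K, v = \sum_i c i *: e i.

Definition is_basis (E : set V) m (e : 'I_m -> V) :=
  [/\ forall i, E (e i),
      forall v, E v -> exists c : 'I_m -> K, v = \sum_i c i *: e i &
      forall c : 'I_m -> K, \sum_i c i *: e i = 0 -> forall i, c i = 0].

Definition eigenspace_of (x : V -> V) (l : K) : set V :=
  [set v | x v = l *: v].

End FiniteDimension.

Definition separable_space (T : topologicalType) :=
  exists D : set T, countable D /\ dense D.

(* The points of [A], with the topology given by a distance [d] that is finite
   on [A].  Only the openness condition is used, so no proof that [d] is a
   distance is needed to form the space. *)
Section MetricSpace.
Context (R : realType) (T : choiceType).

Definition metric_space (d : T -> T -> \bar R) (A : set T) : Type := set_type A.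

Context (d : T -> T -> \bar R) (A : set T).
Local Notation X := (metric_space d A).

HB.instance Definition _ := SubChoice.copy X (set_type A).

Definition metric_open (O : set X) :=
  forall x, O x -> exists2 e : R, 0 < e &
    forall y, (d (\val x) (\val y) < e%:E)%E -> O y.

Let metric_openT : metric_open setT.
Proof. by move=> x _; exists 1. Qed.

Let metric_openI : setI_closed metric_open.
Proof.
move=> O1 O2 o1 o2 x [/o1[e1 e1_gt0 h1] /o2[e2 e2_gt0 h2]].
exists (Num.min e1 e2); first by rewrite lt_min e1_gt0.
move=> y dxy; split; [apply: h1|apply: h2]; apply: (lt_le_trans dxy);
  by rewrite lee_fin ge_min lexx ?orbT.
Qed.

Let metric_open_bigcup (I : Type) (f : I -> set X) :
  (forall i, metric_open (f i)) -> metric_open (\bigcup_i f i).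
Proof.
move=> fo x [i _ /fo[e e_gt0 h]].
by exists e => // y /h fiy; exists i.
Qed.

HB.instance Definition _ :=
  isOpenTopological.Build X metric_openT metric_openI metric_open_bigcup.

End MetricSpace.

Section SymmetricNorming.
Context (R : realType).

Definition finitely_supported (s : R^nat) := \forall n \near \oo, s n = 0.

(* The sequence (a_0, ..., a_(n-1), 0, 0, ...). *)
Definition pad n (a : 'I_n -> R) : R^nat := fun k => oapp a 0 (insub k).

(* [Phi] is a norm on the space of finitely supported sequences; its values at
   other sequences are irrelevant and never used. *)
Record symmetric_norming (Phi : R^nat -> R) : Prop := {
  snf_ge0 : forall s, finitely_supported s -> 0 <= Phi s;
  snf_eq0 : forall s, finitely_supported s -> Phi s = 0 -> s = cst 0;
  snf_scale : forall (c : R) s, finitely_supported s ->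
    Phi (c \*o s) = `|c| * Phi s;
  snf_triangle : forall s t, finitely_supported s -> finitely_supported t ->
    Phi (s \+ t) <= Phi s + Phi t;
  snf_unit : Phi (fun k => (k == 0)%:R) = 1;
  snf_symmetric : forall n (a : 'I_n -> R) (p : 'S_n),
    Phi (pad a) = Phi (pad (fun i => `|a (p i)|))
}.

End SymmetricNorming.

Section Operators.
Context (R : realType) (H : completeNormedModType R[i]) (ip : {dot H for Num.conj}).

Definition inner_product_norm := forall v : H, `|v| ^+ 2 = ip v v.

Definition bounded_op (x : H -> H) := linear x /\ continuous x.

Definition compact_op (x : H -> H) :=
  linear x /\ precompact (x @` [set v | `|v| <= 1]).

Definition finite_rank (x : H -> H) := finite_dim (range x).

(* The default value is never taken when [x] is a bounded operator. *)
Definition adj (x : H -> H) : H -> H :=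
  xget (cst 0) [set y | forall v w, ip (x v) w = ip v (y w)].

Definition normal_op (x : H -> H) := bounded_op x /\ adj x \o x = x \o adj x.

Definition unitary (u : H -> H) :=
  [/\ bounded_op u, adj u \o u = id & u \o adj u = id].

(* [s] lists the square roots of the eigenvalues of x^* x in nonincreasing
   order and with multiplicity, followed by zeros if [x] has finite rank;
   indices start at 0. *)
Definition is_singular_values (x : H -> H) (s : R^nat) :=
  [/\ forall n, 0 <= s n, nonincreasing_seq s &
      forall t : R, 0 < t -> exists m (e : 'I_m -> H),
        is_basis (eigenspace_of (adj x \o x) (t ^+ 2)%:C) e /\
        ([set n | s n = t] #= `I_m)%card].

Definition singular_values (x : H -> H) : R^nat :=
  xget (cst 0) (is_singular_values x).

Context (Phi : R^nat -> R).

Definition normPhi (x : H -> H) : \bar R :=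
  ereal_sup [set (Phi (pad (fun i : 'I_k => singular_values x i)))%:E
            | k in [set k | (0 < k)%N]].

Definition idealPhi : set (H -> H) :=
  [set x | compact_op x /\ (normPhi x < +oo)%E].

Definition distPhi (x y : H -> H) : \bar R := normPhi (x \- y).

Definition unitaryPhi : Type :=
  metric_space distPhi [set u | unitary u /\ idealPhi (u \- id)].

HB.instance Definition _ := Topological.on unitaryPhi.

Context (a : H -> H).

Definition affine_space : Type :=
  metric_space distPhi [set y | idealPhi (y \- a)].

HB.instance Definition _ := Topological.on affine_space.

Definition conj_op (u : unitaryPhi) : H -> H := \val u \o a \o adj (\val u).

Definition unitary_orbit : Type := set_type (range conj_op).

HB.instance Definition _ := SubChoice.on unitary_orbit.

Definition orbit_pi (u : unitaryPhi) : unitary_orbit :=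
  SigSub (mem_set (imageT conj_op u)).

Lemma orbit_surj (y : unitary_orbit) : exists u, orbit_pi u = y.
Proof.
have [u _ uE] := set_mem (valP y).
by exists u; apply: val_inj; rewrite -uE.
Qed.

Definition orbit_repr (y : unitary_orbit) : unitaryPhi :=
  projT1 (cid (orbit_surj y)).

Lemma orbit_reprK : cancel orbit_repr orbit_pi.
Proof. by move=> y; rewrite /orbit_repr; case: cid. Qed.

(* The orbit as the quotient of the group by the fibres of u |-> u a u^*, which
   are the left cosets of the stabilizer of [a], see [orbit_piE]. *)
HB.instance Definition _ :=
  isQuotient.Build unitaryPhi unitary_orbit orbit_reprK.

Lemma orbit_piE (u v : unitaryPhi) : let w := adj (\val u) \o \val v in
  orbit_pi u = orbit_pi v <-> w \o a = a \o w.
Proof.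
have [[_ uu uu'] _] := set_mem (valP u); have [[_ vv vv'] _] := set_mem (valP v).
have app (f g h : H -> H) : f \o g = h -> forall z, f (g z) = h z.
  by move=> <-.
move=> w; split=> [/(congr1 val)/= e|e].
  apply/funext => z; rewrite /w/=.
  have /= := congr1 (fun f => adj (\val u) (f (\val v z))) e.
  by rewrite /conj_op/= (app _ _ _ uu) (app _ _ _ vv).
apply/val_inj/funext => z /=; rewrite /conj_op/=.
have /= := congr1 (fun f => \val u (f (adj (\val v) z))) e.
by rewrite /w/= (app _ _ _ uu') (app _ _ _ vv').
Qed.

(* The traces on the orbit of the open sets of the affine space a + I. *)
Definition inherited_open : set_system unitary_orbit :=
  [set W | exists2 O : set affine_space, open O &
     W = [set y | exists2 z, O z & \val z = \val y]].

End Operators.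

Arguments inherited_open {R H} ip Phi a.

(* Main.v *)
(* For every compact [a], [u |-> u a u^-1] is continuous from the group to
   [a + I], so only the converse comparison of topologies is at stake.

   Singular numbers are used through their description as approximation numbers:
   s_n(x) is the least distance from [x] to an operator of rank at most n.
   Hence s_(m+n)(x + y) <= s_m(x) + s_n(y), and since repeating every entry of a
   sequence at most doubles its Phi, |x + y| <= 2 (|x| + |y|) for the Phi-norm.
   This quasi-triangle inequality suffices for all topological arguments, and
   spares the Ky Fan inequalities.

   If [a] has finite rank and v_k a v_k^-1 -> u a u^-1, the images under v_k of
   an orthonormal basis of the range of [a] cluster at an orthonormal family [g].
   Orthonormal families close to each other are related by a unitary close to 1
   in operator norm which is a perturbation of 1 of bounded rank, hence close to 1
   in the Phi-norm.  So a unitary u' taking the basis to [g] satisfies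
   u' a u'^-1 = u a u^-1, and v_k a v_k^-1 = w_k a w_k^-1 with w_k close to u'.

   If [a] has infinite rank, let [u] exchange eigenvectors e, e' of a^* a for
   distinct small eigenvalues t, t'.  Then u a u^-1 is close to [a], but any
   unitary [w] with w a w^-1 = u a u^-1 has w^-1 e' in the t-eigenspace of a^* a,
   hence orthogonal to e', so [w] stays at distance at least 1 from 1. *)

Require Import Defs.
From mathcomp Require Import all_boot all_order perm all_algebra sesquilinear.
From mathcomp Require Import all_classical all_reals all_analysis.
From mathcomp Require Import ring lra zify.
Import Order.TTheory GRing.Theory Num.Theory numFieldNormedType.Exports.

Set Implicit Arguments.
Unset Strict Implicit.
Unset Printing Implicit Defensive.

Local Open Scope classical_set_scope.
Local Open Scope ring_scope.
Local Open Scope complex_scope.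
Local Notation Re := complex.Re.

(** * Inner products and adjoints *)

Section HilbertBasics.
Context (R : realType) (H : completeNormedModType R[i]) (ip : {dot H for Num.conj}).
Hypothesis ip_norm : inner_product_norm ip.
Implicit Types (u v w : H) (c : R[i]).

(* The norm of [H] takes values in [R[i]]; [nr] and [cn] are its real-valued
   versions on vectors and on scalars. *)
Definition nr (v : H) : R := Re `|v|.

Lemma nrE v : `|v| = (nr v)%:C.
Proof. by rewrite /nr RRe_real// normr_real. Qed.

Lemma nr_ge0 v : 0 <= nr v.
Proof. by rewrite -ler0c -nrE. Qed.

Lemma ipDl w u v : ip (u + v) w = ip u w + ip v w.
Proof. by rewrite linearDl. Qed.
Lemma ipDr w u v : ip w (u + v) = ip w u + ip w v.
Proof. by rewrite linearDr. Qed.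
Lemma ipBl w u v : ip (u - v) w = ip u w - ip v w.
Proof. by rewrite linearBl. Qed.
Lemma ipBr w u v : ip w (u - v) = ip w u - ip w v.
Proof. by rewrite linearBr. Qed.
Lemma ipNl u v : ip (- u) v = - ip u v.
Proof. by rewrite linearNl. Qed.
Lemma ipNr u v : ip u (- v) = - ip u v.
Proof. by rewrite linearNr. Qed.
Lemma ip0l v : ip 0 v = 0.
Proof. by rewrite linear0l. Qed.
Lemma ip0r v : ip v 0 = 0.
Proof. by rewrite linear0r. Qed.
Lemma ipZl c u v : ip (c *: u) v = c * ip u v.
Proof. by rewrite linearZl_LR. Qed.
Lemma ipZr c u v : ip u (c *: v) = conjc c * ip u v.
Proof. by rewrite linearZr_LR. Qed.
Lemma ipZr_real (r : R) u v : ip u (r%:C *: v) = r%:C * ip u v.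
Proof. by rewrite ipZr; congr (_ * _); exact: conjc_real. Qed.
Lemma ipC u v : ip u v = conjc (ip v u).
Proof. by rewrite hermC/= expr0 mul1r. Qed.
Lemma ip_suml (I : Type) (r : seq I) (P : pred I) (F : I -> H) v :
  ip (\sum_(i <- r | P i) F i) v = \sum_(i <- r | P i) ip (F i) v.
Proof. by rewrite linear_sumlz. Qed.
Lemma ip_sumr (I : Type) (r : seq I) (P : pred I) (F : I -> H) v :
  ip v (\sum_(i <- r | P i) F i) = \sum_(i <- r | P i) ip v (F i).
Proof. by rewrite linear_sumr. Qed.

Lemma ip_eq0C u v : ip u v = 0 -> ip v u = 0.
Proof. by move=> uv; rewrite ipC uv conjc0. Qed.

Lemma ipvv v : ip v v = (nr v ^+ 2)%:C.
Proof. by rewrite -ip_norm nrE rmorphXn. Qed.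

Lemma nr_sq v : nr v ^+ 2 = Re (ip v v).
Proof. by rewrite ipvv. Qed.

Lemma nr0 : nr 0 = 0. Proof. by rewrite /nr normr0. Qed.

Lemma nr_eq0 v : nr v = 0 -> v = 0.
Proof. by move=> v0; apply: normr0_eq0; rewrite nrE v0. Qed.

Lemma ip_self_eq0 v : ip v v = 0 -> v = 0.
Proof.
by rewrite ipvv => /complexI/eqP; rewrite sqrf_eq0 => /eqP/nr_eq0.
Qed.

Lemma nr_gt0 v : v <> 0 -> 0 < nr v.
Proof.
by move=> v0; rewrite lt_neqAle nr_ge0 andbT eq_sym; apply/eqP => /nr_eq0.
Qed.

Lemma nrD u v : nr (u + v) <= nr u + nr v.
Proof. by rewrite -lecR rmorphD/= -!nrE ler_normD. Qed.

Lemma nrN v : nr (- v) = nr v.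
Proof. by rewrite /nr normrN. Qed.

Lemma nrB u v : nr (u - v) <= nr u + nr v.
Proof. by rewrite -(nrN v) nrD. Qed.

Lemma nr_distC u v : nr (u - v) = nr (v - u).
Proof. by rewrite -nrN opprB. Qed.

Definition cn (c : R[i]) : R := Re `|c|.

Lemma cnE c : `|c| = (cn c)%:C.
Proof. by rewrite /cn RRe_real// normr_real. Qed.
Lemma cn_ge0 c : 0 <= cn c.
Proof. by rewrite -ler0c -cnE. Qed.
Lemma cn_real (r : R) : cn r%:C = `|r|.
Proof. by rewrite /cn normc_def/= expr0n/= addr0 sqrtr_sqr. Qed.
Lemma cnM c d : cn (c * d) = cn c * cn d.
Proof. by apply: complexI; rewrite rmorphM/= -!cnE normrM. Qed.
Lemma cnD c d : cn (c + d) <= cn c + cn d.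
Proof. by rewrite -lecR rmorphD/= -!cnE ler_normD. Qed.
Lemma cnN c : cn (- c) = cn c.
Proof. by rewrite /cn normrN. Qed.
Lemma cnV c : cn c^-1 = (cn c)^-1.
Proof. by apply: complexI; rewrite fmorphV/= -!cnE normfV. Qed.
Lemma cn0 : cn 0 = 0. Proof. by rewrite /cn normr0. Qed.
Lemma cn_eq0 c : cn c = 0 -> c = 0.
Proof. by move=> c0; apply: normr0_eq0; rewrite cnE c0. Qed.
Lemma cn_Re c : `|Re c| <= cn c.
Proof. by rewrite -lecR -cnE normc_ge_Re. Qed.
Lemma cn_sq c : c * conjc c = (cn c ^+ 2)%:C.
Proof. rewrite -sqr_normc cnE. by rewrite -rmorphXn. Qed.

Lemma nrZ c v : nr (c *: v) = cn c * nr v.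
Proof. by apply: complexI; rewrite rmorphM/= -cnE -!nrE normrZ. Qed.

Lemma nrZr (r : R) v : nr (r%:C *: v) = `|r| * nr v.
Proof. by rewrite nrZ cn_real. Qed.

Lemma cjM c d : conjc (c * d) = conjc c * conjc d. Proof. exact: rmorphM. Qed.
Lemma cjD c d : conjc (c + d) = conjc c + conjc d. Proof. exact: rmorphD. Qed.
Lemma cjN c : conjc (- c) = - conjc c. Proof. exact: rmorphN. Qed.
Lemma cjV c : conjc (c^-1) = (conjc c)^-1. Proof. exact: conjc_inv. Qed.
Lemma cjK c : conjc (conjc c) = c. Proof. exact: conjcK. Qed.
Lemma cj_nat n : conjc (n%:R : R[i]) = n%:R. Proof. exact: conjc_nat. Qed.
Lemma cj_eq0 c : (conjc c == 0) = (c == 0). Proof. exact: conjc_eq0. Qed.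

(** Positivity of [<u - c v, u - c v>] for [c = <u, v> / <v, v>], the coefficient that makes
    [u - c v] orthogonal to [v]. *)
Lemma cauchy_schwarz u v : cn (ip u v) <= nr u * nr v.
Proof.
rewrite -(@ler_pXn2r _ 2) ?nnegrE ?mulr_ge0 ?nr_ge0 ?cn_ge0//.
rewrite exprMn -lecR [leRHS]rmorphM rmorphXn/= -cnE -!ipvv.
have [->|v0] := eqVneq v 0.
  by rewrite !ip0r normr0 expr0n/= mulr0.
have vv : ip v v != 0 by apply: contra_neq v0; apply: ip_self_eq0.
set c := ip u v / ip v v.
have : 0 <= ip (u - c *: v) (u - c *: v) by rewrite -ip_norm exprn_ge0.
rewrite ipBr ipZr (_ : ip (u - c *: v) v = 0); last first.
  by rewrite ipBl ipZl /c divfK// subrr.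
rewrite mulr0 subr0 ipBl ipZl (ipC v u) subr_ge0 /c mulrAC.
have vv0 : 0 < ip v v by rewrite lt_def vv -ip_norm exprn_ge0.
by move=> h; rewrite sqr_normc -(ler_pdivrMr _ _ vv0).
Qed.

Lemma cauchy_schwarz_Re u v : Re (ip u v) <= nr u * nr v.
Proof. exact: le_trans (ler_norm _) (le_trans (cn_Re _) (cauchy_schwarz _ _)). Qed.

Lemma nrD_sq u v : nr (u + v) ^+ 2 = nr u ^+ 2 + nr v ^+ 2 + 2 * Re (ip u v).
Proof.
rewrite !nr_sq !ipDl !ipDr (ipC v u) !raddfD/=.
by case: (ip u v) => a b /=; ring.
Qed.

Lemma nrB_sq u v : nr (u - v) ^+ 2 = nr u ^+ 2 + nr v ^+ 2 - 2 * Re (ip u v).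
Proof. by rewrite nrD_sq nrN ipNr raddfN/= mulrN. Qed.

Lemma pythagoras u v : ip u v = 0 -> nr (u + v) ^+ 2 = nr u ^+ 2 + nr v ^+ 2.
Proof. by move=> uv; rewrite nrD_sq uv/= mulr0 addr0. Qed.

Lemma parallelogram u v :
  nr (u + v) ^+ 2 + nr (u - v) ^+ 2 = 2 * (nr u ^+ 2 + nr v ^+ 2).
Proof. by rewrite nrB_sq nrD_sq; ring. Qed.

Lemma le_of_eps (x y : R) : (forall e : R, 0 < e -> x <= y + e) -> x <= y.
Proof. by move=> h; apply/ler_addgt0Pr. Qed.

Lemma small_eq0 (x C : R) : (forall e : R, 0 < e -> `|x| <= C * e) -> x = 0.
Proof.
move=> h; apply/eqP; rewrite -normr_le0; apply: le_of_eps => e e0; rewrite add0r.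
have C0 : 0 < `|C| + 1 by rewrite ltr_wpDl.
apply: (le_trans (h (e / (`|C| + 1)) _)); first by rewrite divr_gt0.
rewrite mulrCA; apply: ler_piMr; first exact: ltW.
rewrite ler_pdivrMr// mul1r.
by rewrite (le_trans (ler_norm _))// lerDl.
Qed.

Lemma ip_inj u v : (forall w, ip w u = ip w v) -> u = v.
Proof.
move=> h; apply/eqP; rewrite -subr_eq0; apply/eqP/ip_self_eq0.
by rewrite ipBr h subrr.
Qed.

Section LinearFacts.
Context (x : H -> H) (xlin : linear x).
Lemma lin_add u v : x (u + v) = x u + x v.
Proof. by have := xlin 1 u v; rewrite !scale1r. Qed.
Lemma lin0 : x 0 = 0.
Proof. by have := lin_add 0 0; rewrite addr0 => /eqP; rewrite eq_sym -subr_eq0 addrK => /eqP. Qed.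
Lemma lin_scale c u : x (c *: u) = c *: x u.
Proof. by have := xlin c u 0; rewrite !addr0 lin0 addr0. Qed.
Lemma lin_opp u : x (- u) = - x u.
Proof. by rewrite -scaleN1r lin_scale scaleN1r. Qed.
Lemma lin_sub u v : x (u - v) = x u - x v.
Proof. by rewrite lin_add lin_opp. Qed.
Lemma lin_sum (I : Type) (r : seq I) (P : pred I) (F : I -> H) :
  x (\sum_(i <- r | P i) F i) = \sum_(i <- r | P i) x (F i).
Proof. by rewrite (big_morph x lin_add lin0). Qed.
End LinearFacts.

(** Relational form of [adj]: an explicit adjoint can be exhibited and then identified by [adjE],
    while existence for bounded operators waits for the Riesz theorem. *)
Definition is_adj (x y : H -> H) := forall v w, ip (x v) w = ip v (y w).

Lemma is_adj_unique x y y' : is_adj x y -> is_adj x y' -> y = y'.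
Proof. by move=> h h'; apply/funext => w; apply: ip_inj => v; rewrite -h -h'. Qed.

Lemma is_adj_sym x y : is_adj x y -> is_adj y x.
Proof. by move=> h v w; rewrite ipC -h -ipC. Qed.

Lemma adjE x y : is_adj x y -> adj ip x = y.
Proof.
move=> h; rewrite /adj; case: xgetP => [z _ zx|/(_ y)//].
by apply: is_adj_unique h; exact: zx.
Qed.

Lemma is_adj_linear x y : is_adj x y -> linear y.
Proof.
by move=> h c u v; apply: ip_inj => w; rewrite -h !ipDr !ipZr !h.
Qed.

Lemma is_adj_comp x y x' y' : is_adj x y -> is_adj x' y' ->
  is_adj (x \o x') (y' \o y).
Proof. by move=> h h' v w /=; rewrite h h'. Qed.

(** By Cauchy-Schwarz, [|y v|^2 = <x (y v), v> <= B |y v| |v|], and [|y v|] cancels unless it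
    vanishes. *)
Lemma is_adj_bound x y (B : R) : is_adj x y ->
  (forall v, nr (x v) <= B * nr v) -> forall v, nr (y v) <= B * nr v.
Proof.
move=> h xB v; have [y0|y0] := pselect (y v = 0).
  rewrite y0 nr0; have := xB v; have := nr_ge0 (x v); lra.
have yv := nr_gt0 y0; rewrite -(ler_pM2r yv) -expr2 nr_sq -h.
apply: le_trans (cauchy_schwarz_Re _ _) _; rewrite mulrAC ler_wpM2r ?nr_ge0//.
Qed.

End HilbertBasics.

(** * Compact operators *)

Lemma ultra_map (T U : Type) (f : T -> U) (F : set_system T) :
  UltraFilter F -> UltraFilter (f @ F).
Proof.
move=> FU; split; first exact: fmap_proper_filter.
move=> G GF fFG; apply/seteqP; split => // A GA.
have [//|FA] := in_ultra_setVsetC (f @^-1` A) FU.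
have GA' : G (~` A) by exact: fFG.
by have /filter_ex[u []] : G (A `&` ~` A) by exact: filterI.
Qed.

Section Compactness.
Context (R : realType) (H : completeNormedModType R[i]).

(** An ultrafilter finer than [\oo] makes all [N] image sequences converge at once, which replaces
    successive extraction of subsequences. The vectors are scaled by [C^-1] into the unit ball and
    the limits scaled back. *)
Lemma compact_cluster (x : H -> H) N (f : nat -> nat -> H) (C : R) :
  compact_op x -> 0 < C -> (forall i k, (i < N)%N -> nr (f i k) <= C) ->
  exists g : nat -> H, forall n (e : R), 0 < e ->
    exists2 k, (n <= k)%N & forall i, (i < N)%N -> nr (x (f i k) - g i) < e.
Proof.
move=> [xlin xK] C0 fC.
have [G [GU ooG]] := @ultraFilterLemma nat \oo _.
have cvgG i : exists g : H, (i < N)%N ->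
    (fun k => x (C^-1%:C *: f i k)) @ G --> g.
  have [iN|iN] := boolP (i < N)%N; last by exists 0.
  move: xK; rewrite precompactE compact_ultra /= => /(_ ((fun k => x (C^-1%:C *: f i k)) @ G)).
  case; first exact: ultra_map.
    by apply: (@filterE _ G) => k; apply: subset_closure => /=;
      exists (C^-1%:C *: f i k) => //=; rewrite nrE -[1]/(1%:C) lecR nrZr gtr0_norm ?invr_gt0// mulrC ler_pdivrMr// mul1r fC.
  by move=> g [_ /= h]; exists g.
have [g gP] := choice cvgG.
exists (fun i => C%:C *: g i) => n e e0.
have nearG : forall i : 'I_N, \forall k \near G, nr (x (f i k) - C%:C *: g i) < e.
  move=> i; have /cvgr_dist_lt := gP i (ltn_ord i).
  have ec0 : 0 < (e / C)%:C by rewrite -[0]/(0%:C) ltcR divr_gt0.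
  move=> /(_ _ ec0); apply: filterS => k.
  rewrite nrE ltcR ltr_pdivlMr// mulrC; apply: le_lt_trans.
  rewrite -[X in X * _]gtr0_norm// -nrZr scalerBr -lin_scale// scalerA -rmorphM/= mulfV ?gt_eqF//.
  by rewrite scale1r nr_distC.
have hG := filter_forall _ nearG.
have [k [h1 /= nk]] := @filter_ex _ G _ _ (@filterI _ G _ _ _ (hG _) (ooG _ (nbhs_infty_ge n))).

exists k => // i iN.
exact: (h1 (Ordinal iN)).
Qed.

(** Otherwise there are [f k] in the unit ball with [|x (f k)| > k], and these images could not
    cluster at a vector, whose norm is finite. *)
Lemma compact_op_bound (x : H -> H) : compact_op x ->
  exists2 B : R, 0 <= B & forall v, nr (x v) <= B * nr v.
Proof.
move=> xc; have [xlin _] := xc.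
have [[B0 hB0]|/forallNP h] := pselect (exists B : R, forall v, nr v <= 1 -> nr (x v) <= B).
  have B00 : 0 <= B0 by rewrite (le_trans (nr_ge0 _) (hB0 0 _))// nr0.
  exists B0 => // v; have [->|/nr_gt0 v0] := pselect (v = 0).
    by rewrite (lin0 xlin) nr0 mulr0.
  have := hB0 ((nr v)^-1%:C *: v); rewrite (lin_scale xlin) !nrZr gtr0_norm ?invr_gt0//.
  by rewrite mulVf ?gt_eqF// mulrC ler_pdivrMr//; apply.
have /choice[f fP] : forall k : nat, exists v, nr v <= 1 /\ k%:R < nr (x v).
  move=> k; have /existsNP[v /not_implyP[v1 /negP]] := h k%:R.
  by rewrite -ltNge => ?; exists v.
have [||g gP] := @compact_cluster x 1 (fun _ => f) 1 xc; rewrite ?ltr01//.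
  by move=> i k _; case: (fP k).
have [k nk /(_ 0 isT) hk] := gP (Num.truncn (nr (g 0) + 1)).+1 1 ltr01.
have [_ fk] := fP k.
have := nrD (x (f k) - g 0) (g 0); rewrite subrK.
have : nr (g 0) + 1 < k%:R.
  apply: lt_le_trans (_ : (Num.truncn (nr (g 0) + 1)).+1%:R <= _); last by rewrite ler_nat.
  exact: truncnS_gt.
lra.
Qed.

Lemma linear_bounded_continuous (x : H -> H) (B : R) : linear x ->
  (forall v, nr (x v) <= B * nr v) -> continuous x.
Proof.
move=> xlin xB v; apply/cvgrPdist_lt => e e0.
have eE : e = (Re e)%:C by rewrite RRe_real// gtr0_real.
have B0 : 0 < `|B| + 1 by rewrite ltr_wpDl.
have e'0 : 0 < (Re e / (`|B| + 1))%:C.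
  by rewrite -[0]/(0%:C) ltcR divr_gt0// -ltcR -eE.
near=> w.
have : `|v - w| < (Re e / (`|B| + 1))%:C.
  by near: w; exact: (@cvgr_dist_lt _ _ _ (nbhs v)).
rewrite -lin_sub// !nrE eE !ltcR ltr_pdivlMr// mulrC; apply: le_lt_trans.
apply: le_trans (xB _) _; rewrite ler_wpM2r ?nr_ge0//.
by rewrite (le_trans (ler_norm _))// lerDl.
Unshelve. all: by end_near. Qed.

Lemma scalar_continuous (c : R[i]) : continuous (fun v : H => c *: v).
Proof.
apply: (@linear_bounded_continuous _ (cn c)).
  by move=> d u v; rewrite scalerDr !scalerA mulrC.
by move=> v; rewrite nrZ.
Qed.

(** By homogeneity, compactness can be tested on a ball of any radius, with any compact set that
    contains the image. *)
Lemma compact_opP (x : H -> H) (K : set H) (C : R) : linear x -> 0 < C -> compact K ->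
  (forall v, nr v <= C -> K (x v)) -> compact_op x.
Proof.
move=> xlin C0 cK xK; split => //.
apply: (@precompact_subset _ _ ((fun v => C^-1%:C *: v) @` K)).
  move=> _ [v /= v1 <-]; exists (x (C%:C *: v)) => /=.
    apply: xK; rewrite nrZr gtr0_norm//; apply: ler_piMr; first exact: ltW.
    by move: v1; rewrite nrE -[1]/(1%:C) lecR.
  by rewrite (lin_scale xlin) scalerA -rmorphM/= mulVf ?gt_eqF// scale1r.
have cK' : compact ((fun v : H => C^-1%:C *: v) @` K).
  apply: continuous_compact => //; apply: continuous_subspaceT.
  exact: scalar_continuous.
rewrite precompact_closed//; apply: compact_closed => //.
Qed.

Lemma compact_op_image (x : H -> H) (C : R) : compact_op x -> 0 < C ->
  exists2 K : set H, compact K & forall v, nr v <= C -> K (x v).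
Proof.
move=> [xlin]; rewrite precompactE => cK C0.
exists ((fun v : H => C%:C *: v) @` (closure (x @` [set v | `|v| <= 1]))).
  apply: continuous_compact => //; apply: continuous_subspaceT.
  exact: scalar_continuous.
move=> v vC; exists (x (C^-1%:C *: v)).
  apply: subset_closure; exists (C^-1%:C *: v) => //=.
  by rewrite nrE -[1]/(1%:C) lecR nrZr gtr0_norm ?invr_gt0// mulrC ler_pdivrMr// mul1r.
by rewrite (lin_scale xlin) scalerA -rmorphM/= mulfV ?gt_eqF// scale1r.
Qed.

Lemma compact_opD (x y : H -> H) : compact_op x -> compact_op y -> compact_op (x \+ y).
Proof.
move=> xc yc; have [xl _] := xc; have [yl _] := yc.
have [K cK xK] := compact_op_image xc ltr01.
have [L cL yL] := compact_op_image yc ltr01.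
apply: (@compact_opP _ ((fun z : H * H => z.1 + z.2) @` (K `*` L)) 1) => //.
- by move=> c u v /=; rewrite xl yl scalerDr addrACA.
- apply: continuous_compact; last exact: compact_setX.
  by apply: continuous_subspaceT => z; apply: cvgD; [exact: cvg_fst|exact: cvg_snd].
- by move=> v v1; exists (x v, y v) => //=; split; [exact: xK|exact: yL].
Qed.

Lemma compact_op_compl (b x : H -> H) (B : R) : compact_op x -> linear b ->
  (forall v, nr (b v) <= B * nr v) -> compact_op (b \o x).
Proof.
move=> xc bl bB; have [xl _] := xc.
have [K cK xK] := compact_op_image xc ltr01.
apply: (@compact_opP _ (b @` K) 1) => //.
- by move=> c u v /=; rewrite xl bl.
- apply: continuous_compact => //; apply: continuous_subspaceT.
  exact: linear_bounded_continuous bB.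
- by move=> v v1; exists (x v) => //; exact: xK.
Qed.

Lemma compact_op_compr (b x : H -> H) (B : R) : compact_op x -> linear b ->
  (forall v, nr (b v) <= B * nr v) -> compact_op (x \o b).
Proof.
move=> xc bl bB; have [xl _] := xc.
have B0 : 0 < `|B| + 1 by rewrite ltr_wpDl.
have [K cK xK] := compact_op_image xc B0.
apply: (@compact_opP _ K 1) => //.
- by move=> c u v /=; rewrite bl xl.
- move=> v v1; apply: xK; apply: le_trans (bB v) _.
  apply: (@le_trans _ _ (`|B| * nr v)); first by rewrite ler_wpM2r ?nr_ge0// ler_norm.
  have := normr_ge0 B; nra.
Qed.

Lemma real_scale_continuous (g : H) : continuous (fun r : R => r%:C *: g).
Proof.
move=> r; apply/cvgrPdist_lt => e e0.
have eE : e = (Re e)%:C by rewrite RRe_real// gtr0_real.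
have Re0 : 0 < Re e by rewrite -ltcR -eE.
have g0 : 0 < nr g + 1 by rewrite ltr_wpDl ?nr_ge0.
near=> s; have : `|r - s| < Re e / (nr g + 1).
  by near: s; apply: (@cvgr_dist_lt _ _ _ (nbhs r)) => //; rewrite divr_gt0.
rewrite -scalerBl -rmorphB nrE eE ltcR nrZr ltr_pdivlMr//.
by apply: le_lt_trans; rewrite ler_wpM2l// lerDl.
Unshelve. all: by end_near. Qed.

(** The disc of scalars lies in a square of real and imaginary parts, a product of compact segments
    that is mapped continuously to the line. *)
Lemma line_compact (g : H) (C : R) :
  exists2 K : set H, compact K & forall c, cn c <= C -> K (c *: g).
Proof.
exists ((fun z : R * R => z.1%:C *: g + z.2%:C *: ('i%C *: g)) @`
  (`[- C, C] `*` `[- C, C])).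
  apply: continuous_compact.
    apply: continuous_subspaceT => z; apply: cvgD.
      exact: (continuous_comp (@cvg_fst _ _ _ _ _) (@real_scale_continuous g _)).
    exact: (continuous_comp (@cvg_snd _ _ _ _ _) (@real_scale_continuous _ _)).
  by apply: compact_setX; exact: segment_compact.
move=> c cC; exists (Re c, complex.Im c); last first.
  by rewrite /= scalerA -scalerDl [_ * 'i%C]mulrC -complexE.
have h1 := le_trans (cn_Re c) cC.
have h2 : `|complex.Im c| <= C.
  have -> : complex.Im c = - Re (c * 'i%C) by rewrite ReiNIm opprK.
  rewrite normrN (le_trans (cn_Re _))// cnM (_ : cn 'i%C = 1) ?mulr1//.
  by rewrite /cn normc_def/= expr0n/= add0r expr1n sqrtr1.
by split => /=; rewrite in_itv/= -ler_norml.
Qed.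

Lemma rank_one_compact (phi : H -> R[i]) (g : H) (B : R) :
  (forall c u v, phi (c *: u + v) = c * phi u + phi v) ->
  (forall v, cn (phi v) <= B * nr v) -> compact_op (fun v => phi v *: g).
Proof.
move=> phil phiB; have [K cK KP] := line_compact g `|B|.
apply: (@compact_opP _ K 1) => //.
  by move=> c u v; rewrite phil scalerDl scalerA.
move=> v v1; apply: KP; apply: le_trans (phiB v) _.
have := nr_ge0 v; have := ler_norm B; have := normr_ge0 B; nra.
Qed.

End Compactness.

(** * The Riesz representation theorem *)

Section Riesz.
Context (R : realType) (H : completeNormedModType R[i]) (ip : {dot H for Num.conj}).
Hypothesis ip_norm : inner_product_norm ip.

Lemma invS_small (d : R) : 0 < d ->
  exists N, forall n, (N <= n)%N -> n.+1%:R^-1 < d.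
Proof.
move=> d0; have [N _ NP] := near_infty_natSinv_lt (PosNum d0).
by exists N => n Nn; exact: NP.
Qed.

Lemma nr_complete (f : nat -> H) :
  (forall e : R, 0 < e -> exists N, forall m n, (N <= m)%N -> (N <= n)%N ->
     nr (f m - f n) < e) ->
  exists l, forall e : R, 0 < e -> exists N, forall n, (N <= n)%N -> nr (f n - l) < e.
Proof.
move=> fC; have : cvg (f @ \oo).
  apply/cauchy_cvgP/cauchy_exP => e e0.
  have eE : e = (Re e)%:C by rewrite RRe_real// gtr0_real.
  have [|N NP] := fC (Re e); first by rewrite -ltcR -eE.
  exists (f N); exists N => // n Nn /=; rewrite -ball_normE /ball_/= nrE eE ltcR.
  exact: NP.
move=> /cvgrPdist_lt fl; exists (lim (f @ \oo)) => e e0.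
have [|N _ NP] := fl e%:C; first by rewrite -[0]/(0%:C) ltcR.
exists N => n Nn; rewrite -ltcR -nrE distrC; exact: NP.
Qed.

(** First-order condition at a minimum: the value [t = - r / (q + 1)] already makes the expression
    negative unless [r = 0]. *)
Lemma linear_term_eq0 (r q : R) : 0 <= q ->
  (forall t, 0 <= 2 * t * r + t ^+ 2 * q) -> r = 0.
Proof.
move=> q0 /(_ (- r / (q + 1))).
have q1 : 0 < q + 1 by rewrite ltr_wpDl.
have -> : 2 * (- r / (q + 1)) * r + (- r / (q + 1)) ^+ 2 * q =
  - (r ^+ 2 * (q + 2)) / (q + 1) ^+ 2 by field; rewrite gt_eqF.
rewrite pmulr_lge0 ?invr_gt0 ?exprn_gt0// => h.
have h2 := sqr_ge0 r.
apply/eqP; rewrite -sqrf_eq0; apply/eqP; nra.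
Qed.

(** The supremum [S] of [Re phi] on the unit ball is attained, because the parallelogram law makes a
    maximizing sequence Cauchy. At a maximizer [l] a variation argument gives
    [Re (phi u) = S Re <u, l>], so [S l] represents [phi]. *)
Lemma riesz (phi : H -> R[i]) (B : R) :
  (forall c u v, phi (c *: u + v) = c * phi u + phi v) ->
  (forall v, cn (phi v) <= B * nr v) -> exists w, forall v, phi v = ip v w.
Proof.
move=> phil phiB.
have phiD u v : phi (u + v) = phi u + phi v by have := phil 1 u v; rewrite scale1r mul1r.
have phi0 : phi 0 = 0.
  by have /eqP := phiD 0 0; rewrite addr0 eq_sym -subr_eq0 addrK => /eqP.
have phiZ c u : phi (c *: u) = c * phi u by have := phil c u 0; rewrite phi0 !addr0.
have phiRZ (r : R) u : Re (phi (r%:C *: u)) = r * Re (phi u).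
  by rewrite phiZ; case: (phi u) => a b /=; rewrite mul0r subr0.
have phiDR u v : Re (phi (u + v)) = Re (phi u) + Re (phi v) by rewrite phiD raddfD.
have phiReB v : `|Re (phi v)| <= B * nr v by exact: le_trans (cn_Re _) (phiB _).
pose E := [set Re (phi v) | v in [set v | nr v <= 1]].
have B0 : 0 <= `|B| by [].
have Esup : has_sup E.
  split; first by exists 0; exists 0; rewrite /= ?nr0// phi0.
  exists `|B| => _ [v /= v1 <-]; apply: le_trans (ler_norm _) (le_trans (phiReB v) _).
  have := nr_ge0 v; have := ler_norm B; nra.
pose S := sup E.
have S0 : 0 <= S by apply: sup_upper_bound => //; exists 0; rewrite /= ?nr0// phi0.
have SP v : Re (phi v) <= S * nr v.
  have [->|/nr_gt0 v0] := pselect (v = 0); first by rewrite phi0 nr0 mulr0.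
  rewrite -ler_pdivrMr// mulrC -phiRZ; apply: sup_upper_bound => //.
  exists ((nr v)^-1%:C *: v) => //=.
  by rewrite nrZr gtr0_norm ?invr_gt0// mulVf ?gt_eqF.
(* Real parts determine a complex linear functional: the imaginary part at [u] is read off from the
   real part at [i u]. *)
have ReIm w : (forall u, Re (phi u) = Re (ip u w)) -> forall u, phi u = ip u w.
  move=> h u; rewrite [LHS]complexE [RHS]complexE h; congr (_ + 'i%C * _).
  have := h ('i%C *: u); rewrite phiZ ipZl ![ 'i%C * _]mulrC !ReiNIm => /eqP.
  by rewrite eqr_opp => /eqP ->.
have [Sz|Snz] := eqVneq S 0.
  exists 0; apply: ReIm => u; rewrite ip0r /=; apply/eqP; rewrite eq_le.
  have := SP u; rewrite Sz mul0r => -> /=.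
  have := SP (- u); rewrite Sz mul0r -scaleN1r.
  rewrite -[(- 1 : R[i])]/(- (1%:C)) -rmorphN phiRZ; lra.
have Sp : 0 < S by rewrite lt_def Snz.
have /choice[f fP] : forall k : nat, exists v, nr v <= 1 /\ S - k.+1%:R^-1 < Re (phi v).
  move=> k; have k0 : 0 < (k.+1%:R^-1 : R) by rewrite invr_gt0.
  by have [_ [v v1 <-] h] := sup_adherent k0 Esup; exists v.
have [l lP] : exists l, forall e : R, 0 < e -> exists N, forall n, (N <= n)%N -> nr (f n - l) < e.
  (* Both values exceed [S - d], so [|f m + f n| > 2 (S - d) / S], and the parallelogram law gives
     [|f m - f n|^2 < 8 d / S <= e^2]. The cap [d <= S] keeps [S - d] nonnegative for squaring. *)
  apply: nr_complete => e e0; pose d := Num.min S (e ^+ 2 * S / 8).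
  have d0 : 0 < d by rewrite /d lt_min Sp divr_gt0// mulr_gt0// exprn_gt0.
  have [N NP] := invS_small d0; exists N => m n Nm Nn.
  have [fm1 fm2] := fP m; have [fn1 fn2] := fP n.
  have {}fm2 : S - d < Re (phi (f m)).
    by apply: lt_trans fm2; rewrite ltrD2l ltrN2; exact: NP.
  have {}fn2 : S - d < Re (phi (f n)).
    by apply: lt_trans fn2; rewrite ltrD2l ltrN2; exact: NP.
  have dS : d <= S by rewrite /d ge_min lexx.
  have de : d <= e ^+ 2 * S / 8 by rewrite /d ge_min lexx orbT.
  rewrite -(@ltr_pXn2r _ 2) ?nnegrE ?nr_ge0 ?(ltW e0)//.
  have := parallelogram ip_norm (f m) (f n).
  have := SP (f m + f n); rewrite phiDR => hS.
  have := nr_ge0 (f m + f n); have := nr_ge0 (f m); have := nr_ge0 (f n).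
  move: (nr (f m)) (nr (f n)) (nr (f m + f n)) (nr (f m - f n)) fm1 fn1 hS.
  move=> a b c x a1 b1 hS b0 a0 c0 par.
have h1 : 2 * (S - d) < S * c by lra.
  have h2 : (2 * (S - d)) ^+ 2 < (S * c) ^+ 2.
    by rewrite ltr_pXn2r ?nnegrE ?mulr_ge0//; lra.
  have a2 : a ^+ 2 <= 1 by rewrite expr_le1.
  have b2 : b ^+ 2 <= 1 by rewrite expr_le1.
  have h3 : 4 * S ^+ 2 - 8 * S * d < S ^+ 2 * c ^+ 2.
    by rewrite -exprMn; apply: le_lt_trans h2; have := sqr_ge0 d; nra.
  have h4 : S ^+ 2 * x ^+ 2 < S ^+ 2 * e ^+ 2.
    have : S ^+ 2 * x ^+ 2 <= S ^+ 2 * (4 - c ^+ 2).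
      by apply: ler_wpM2l; [exact: sqr_ge0|lra].
    have : 8 * S * d <= S ^+ 2 * e ^+ 2 by have := ler_wpM2l S0 de; lra.
    lra.
  by rewrite ltr_pM2l ?exprn_gt0 in h4.
have l1 : nr l <= 1.
  apply: le_of_eps => e /lP[N /(_ _ (leqnn N))]; have [fN _] := fP N.
  have := nrB (f N) (f N - l); rewrite subKr; lra.
have phil' : S <= Re (phi l).
  apply: le_of_eps => e e0; have B1 : 0 < `|B| + 1 by lra.
  have [N1 N1P] := lP (e / 2 / (`|B| + 1)) ltac:(by rewrite !divr_gt0).
  have [N2 N2P] := @invS_small (e / 2) ltac:(by rewrite divr_gt0).
  have := N1P _ (leq_maxl N1 N2); have := N2P _ (leq_maxr N1 N2).
  set n := maxn _ _ => h2 h1; have [_ h3] := fP n.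
  have {h2}h3 : S - e / 2 < Re (phi (f n)) by apply: lt_trans h3; rewrite ltrD2l ltrN2.
  rewrite ltr_pdivlMr// in h1.
  have := phiReB (f n - l); rewrite -[- l]scaleN1r.
  rewrite -[(- 1 : R[i])]/(- (1%:C)) -rmorphN phiDR phiRZ rmorphN scaleN1r ler_norml.
  have := ler_norm B; have := nr_ge0 (f n - l) => h4 h5 /andP[_ h6]; nra.
have nl : nr l = 1.
  apply/eqP; rewrite eq_le l1/= -(ler_pM2l Sp) mulr1.
  by apply: le_trans (SP l).
have phil1 : Re (phi l) = S by apply/eqP; rewrite eq_le phil' -[X in _ <= X]mulr1 -nl SP.
exists (S%:C *: l); apply: ReIm => u.
have := phiRZ (- (Re (phi u) / S)) l; rewrite phil1 mulNr divfK// => pu.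
(* [Re phi] vanishes at [u'], so it equals [S] along the real line [l + t u']. Hence the norm is at
   least 1 on this line, with minimum at [l], and [Re <l, u'> = 0]. *)
pose u' := u + (- (Re (phi u) / S))%:C *: l.
have pu' : Re (phi u') = 0 by rewrite phiDR pu subrr.
have : Re (ip l u') = 0.
  apply: (@linear_term_eq0 _ (nr u' ^+ 2)); first exact: sqr_ge0.
  move=> t; have := SP (l + t%:C *: u').
  rewrite phiDR phiRZ pu' mulr0 addr0 phil1 => h.
  have h1 : 1 <= nr (l + t%:C *: u') by rewrite -(ler_pM2l Sp) mulr1.
  have : 1 <= nr (l + t%:C *: u') ^+ 2 by rewrite expr_ge1// nr_ge0.
  rewrite (nrD_sq ip_norm) nl nrZr exprMn real_normK ?num_real// ipZr.
  have -> : Re (conjc t%:C * ip l u') = t * Re (ip l u').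
    by case: (ip l u') => a b /=; ring.
  lra.
rewrite /u' ipDr ipZr (ipvv ip_norm) nl expr1n mulr1 raddfD/= => h.
rewrite ipZr (ipC _ u l); move: h; case: (ip l u) => a b /= h.
have e1 : Re (phi u) / S = a by lra.
have -> : Re (phi u) = S * a by rewrite -e1 mulrC divfK.
by rewrite oppr0 mul0r subr0.
Qed.

(** For each [w] the functional [v |-> <x v, w>] is bounded, and its Riesz vector is the value of
    the adjoint at [w]. *)
Lemma bounded_adj (x : H -> H) (B : R) : linear x ->
  (forall v, nr (x v) <= B * nr v) -> is_adj ip x (adj ip x).
Proof.
move=> xl xB; suff [y xy] : exists y, is_adj ip x y by rewrite (adjE ip_norm xy).
have /choice[y yP] : forall w, exists z, forall v, ip (x v) w = ip v z.
  move=> w; apply: (@riesz (fun v => ip (x v) w) (B * nr w)).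
    by move=> c u v; rewrite xl ipDl ipZl.
  move=> v; apply: le_trans (cauchy_schwarz ip_norm _ _) _.
  by rewrite mulrAC ler_wpM2r ?nr_ge0.
by exists y => v w; exact: yP.
Qed.

Lemma compact_adj (x : H -> H) : compact_op x -> is_adj ip x (adj ip x).
Proof. by move=> xc; have [B _ xB] := compact_op_bound xc; exact: bounded_adj xc.1 xB. Qed.

End Riesz.

(** * Singular numbers *)

Section LinearAlgebra.
Context (K : fieldType) (V : lmodType K).

(** The [n] by [m] coefficient matrix has rank at most [m < n], so its left kernel has a nonzero
    row, which supplies the coefficients. *)
Lemma span_dependent m n (f : 'I_m -> V) (g : 'I_n -> V) : (m < n)%N ->
  (forall i, exists c : 'I_m -> K, g i = \sum_j c j *: f j) ->
  exists2 c : 'I_n -> K, exists i, c i != 0 & \sum_i c i *: g i = 0.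
Proof.
move=> mn /choice[A gA]; pose M := \matrix_(i < n, j < m) A i j.
have : kermx M != 0.
  rewrite kermx_eq0 /row_free; apply: contraL mn => /eqP <-.
  by rewrite -leqNgt rank_leq_col.
move=> /matrix0Pn[i [j ij]].
have kM : kermx M *m M = 0 by rewrite mulmx_ker.
exists (fun k => kermx M i k); first by exists j.
under eq_bigr do rewrite gA scaler_sumr.
rewrite exchange_big/= big1// => l _.
under eq_bigr do rewrite scalerA.
rewrite -scaler_suml (_ : \sum_k _ = 0) ?scale0r//.
transitivity ((kermx M *m M) i l); last by rewrite kM mxE.
by rewrite mxE; apply: eq_bigr => k _; rewrite [M k l]mxE.
Qed.

End LinearAlgebra.

(** * Orthonormal families and their projections *)

Section Orthonormal.
Context (R : realType) (H : completeNormedModType R[i]) (ip : {dot H for Num.conj}).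
Hypothesis ip_norm : inner_product_norm ip.

Definition orthon n (e : nat -> H) :=
  forall i j, (i < n)%N -> (j < n)%N -> ip (e i) (e j) = (i == j)%:R.

Definition perp n (e : nat -> H) v := forall i, (i < n)%N -> ip v (e i) = 0.

Definition proj n (e : nat -> H) v := \sum_(i < n) ip v (e i) *: e i.

Lemma ip_lin_comb n e (c : 'I_n -> R[i]) (j : 'I_n) : orthon n e ->
  ip (\sum_i c i *: e i) (e j) = c j.
Proof.
move=> on; rewrite ip_suml (bigD1 j)//= ipZl on// eqxx mulr1 big1 ?addr0// => i ij.
by rewrite ipZl on//; move/negPf: ij => /= ij; rewrite (_ : (i == j :> nat) = false)// mulr0.
Qed.

Lemma proj_ip n e v j : orthon n e -> (j < n)%N -> ip (proj n e v) (e j) = ip v (e j).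
Proof. by move=> on jn; rewrite /proj (ip_lin_comb (fun i => ip v (e i)) (Ordinal jn)). Qed.

Lemma perp_proj n e v : orthon n e -> perp n e (v - proj n e v).
Proof. by move=> on i i_n; rewrite ipBl proj_ip// subrr. Qed.

Lemma perp_ip_proj n e v w : perp n e v -> ip v (proj n e w) = 0.
Proof. by move=> vp; rewrite ip_sumr big1// => i _; rewrite ipZr vp// mulr0. Qed.

Lemma nr_proj n e v : orthon n e ->
  nr v ^+ 2 = nr (v - proj n e v) ^+ 2 + nr (proj n e v) ^+ 2.
Proof.
move=> on; rewrite -(pythagoras ip_norm) ?subrK//.
by apply: perp_ip_proj; exact: perp_proj.
Qed.

Lemma nrB_proj_le n e v : orthon n e -> nr (v - proj n e v) <= nr v.
Proof.
move=> on; rewrite -(@ler_pXn2r _ 2) ?nnegrE ?nr_ge0//.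
by rewrite (nr_proj v on) lerDl sqr_ge0.
Qed.

Lemma orthon_nr n e i : orthon n e -> (i < n)%N -> nr (e i) = 1.
Proof.
move=> on i_n; apply/eqP; rewrite -(@eqrXn2 _ 2) ?nr_ge0//.
by rewrite (nr_sq ip_norm) on// eqxx expr1n.
Qed.

Lemma orthon_free n e (c : 'I_n -> R[i]) : orthon n e ->
  \sum_i c i *: e i = 0 -> forall i, c i = 0.
Proof. by move=> on s0 i; rewrite -(ip_lin_comb c i on) s0 ip0l. Qed.

Lemma orthonS n e : orthon n e -> perp n e (e n) -> nr (e n) = 1 -> orthon n.+1 e.
Proof.
move=> on pe n1 i j; rewrite !ltnS leq_eqVlt => /predU1P[->|i_n].
  rewrite leq_eqVlt => /predU1P[->|jn].
    by rewrite (ipvv ip_norm) n1 eqxx expr1n.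
  by rewrite pe// gtn_eqF.
rewrite leq_eqVlt => /predU1P[->|jn]; last exact: on.
by rewrite ipC pe// ltn_eqF// conjc0.
Qed.

Lemma normalize (v : H) : v <> 0 -> nr ((nr v)^-1%:C *: v) = 1.
Proof.
by move=> /nr_gt0 v0; rewrite nrZr gtr0_norm ?invr_gt0// mulVf// gt_eqF.
Qed.

(** If no such [w] existed, every [v - proj n e v] would vanish and the [n] vectors would span
    [H]. *)
Lemma unit_perp n e : orthon n e -> ~ finite_dim [set: H] ->
  exists w, nr w = 1 /\ perp n e w.
Proof.
move=> on Hinf; apply: contrapT => h; apply: Hinf; exists n, (fun i => e i) => v _.
exists (fun i => ip v (e i)); apply/eqP; rewrite -subr_eq0 -/(proj n e v).
apply/eqP; apply: contrapT => vn; apply: h; eexists; split; first exact: normalize vn.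
by move=> i i_n; rewrite ipZl perp_proj// mulr0.
Qed.

Lemma cn_small_eq0 (z : R[i]) (C : R) : (forall e : R, 0 < e -> cn z <= C * e) -> z = 0.
Proof.
move=> h; apply/cn_eq0/(@small_eq0 _ _ C) => e /h.
by rewrite ger0_norm ?cn_ge0.
Qed.

End Orthonormal.

(** * Maximal eigenvectors on orthogonal complements *)

Section SingularSystem.
Context (R : realType) (H : completeNormedModType R[i]) (ip : {dot H for Num.conj}).
Hypothesis ip_norm : inner_product_norm ip.
Hypothesis H_infinite : ~ finite_dim [set: H].
Local Notation perp := (perp ip).
Local Notation orthon := (orthon ip).

(** The vector [w] maximizes [|x v|] over the unit ball of the complement of [e]. With [M] the
    supremum, a maximizing sequence is asymptotically equal to [M^-2 y (x v)], and compactness of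
    [x] makes the latter cluster. If [M = 0], any unit vector of the complement serves. *)
Lemma max_eigenvector (x y : H -> H) n e : compact_op x -> is_adj ip x y ->
  orthon n e -> (forall i, (i < n)%N -> exists l, y (x (e i)) = l *: e i) ->
  exists w, [/\ nr w = 1, perp n e w, y (x w) = (nr (x w) ^+ 2)%:C *: w &
    forall v, perp n e v -> nr (x v) <= nr (x w) * nr v].
Proof.
move=> xc xy on eT; have [xl _] := xc; have [B B0 xB] := compact_op_bound xc.
have yB := is_adj_bound ip_norm xy xB; have yl := is_adj_linear ip_norm xy.
(* The complement of eigenvectors of the self-adjoint [y \o x] is invariant under it. *)
have Tperp v : perp n e v -> perp n e (y (x v)).
  move=> vp i i_n; have [l el] := eT i i_n.
  by rewrite ipC -xy ipC conjcK xy el ipZr vp ?mulr0.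
pose E := [set nr (x v) | v in [set v | nr v <= 1 /\ perp n e v]].
have E0 : E 0.
  by exists 0; [split; [rewrite nr0|move=> i _; rewrite ip0l]|rewrite (lin0 xl) nr0].
have Esup : has_sup E.
  split; first by exists 0.
  exists B => _ [v [v1 _] <-]; apply: le_trans (xB v) _.
  have := nr_ge0 v; nra.
pose M := sup E.
have M0 : 0 <= M by exact: sup_upper_bound.
have MP v : perp n e v -> nr (x v) <= M * nr v.
  move=> vp; have [->|v0] := pselect (v = 0); first by rewrite (lin0 xl) nr0 mulr0.
  have vn := nr_gt0 v0; rewrite -ler_pdivrMr// mulrC.
  rewrite -[X in X * _]gtr0_norm ?invr_gt0// -nrZr -(lin_scale xl).
  apply: sup_upper_bound => //; eexists; last reflexivity.
  by split; [rewrite normalize|move=> i i_n; rewrite ipZl vp// mulr0].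
have [Mz|Mnz] := eqVneq M 0.
  have [w [w1 wp]] := unit_perp on H_infinite.
  have xw : nr (x w) = 0.
    by apply/eqP; rewrite eq_le nr_ge0 andbT; have := MP _ wp; rewrite Mz mul0r.
  exists w; split => //; last by move=> v vp; rewrite xw -Mz; exact: MP.
  by rewrite (nr_eq0 xw) (lin0 yl) nr0 expr0n/= scale0r.
have Mp : 0 < M by rewrite lt_def Mnz.
have M2 : 0 < M ^+ 2 by rewrite exprn_gt0.
(* Expanding the square, the cross term is [- 2 M^2 |x v|^2]. By invariance of the complement
   [|y (x v)| <= M |x v|], which offsets half of it. *)
have est v : perp n e v -> nr v <= 1 ->
    nr (y (x v) - (M ^+ 2)%:C *: v) ^+ 2 <= M ^+ 2 * (M ^+ 2 - nr (x v) ^+ 2).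
  move=> vp v1; rewrite (nrB_sq ip_norm) nrZr gtr0_norm// ipZr.
  have -> : Re (conjc (M ^+ 2)%:C * ip (y (x v)) v) = M ^+ 2 * nr (x v) ^+ 2.
    rewrite (_ : ip _ _ = (nr (x v) ^+ 2)%:C) /=; first by ring.
    by rewrite ipC -xy (ipvv ip_norm) conjc_real.
  have h1 : nr (y (x v)) ^+ 2 <= M ^+ 2 * nr (x v) ^+ 2.
    rewrite -exprMn ler_pXn2r ?nnegrE ?mulr_ge0 ?nr_ge0//.
    have [->|yx0] := pselect (y (x v) = 0); first by rewrite nr0 mulr_ge0 ?nr_ge0.
    rewrite -(ler_pM2l (nr_gt0 yx0)) -expr2 (nr_sq ip_norm) -xy.
    apply: le_trans (cauchy_schwarz_Re ip_norm _ _) _.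
    rewrite mulrA [_ * M]mulrC ler_wpM2r ?nr_ge0//.
    by apply: MP; exact: Tperp.
  have h2 : (M ^+ 2 * nr v) ^+ 2 <= M ^+ 2 * M ^+ 2.
    rewrite -expr2 ler_pXn2r ?nnegrE ?mulr_ge0 ?nr_ge0// ?ler_piMr//; exact: ltW.
  lra.
have /choice[f fP] : forall k : nat, exists v, [/\ nr v <= 1, perp n e v & M - k.+1%:R^-1 < nr (x v)].
  move=> k; have k0 : 0 < (k.+1%:R^-1 : R) by rewrite invr_gt0.
  by have [_ [v [v1 vp] <-] h] := sup_adherent k0 Esup; exists v.
have [|g gP] := compact_cluster (N := 1) (f := fun _ => f) xc ltr01.
  by move=> i k _; have [] := fP k.
pose w := (M ^- 2)%:C *: y (g 0).
have near d : 0 < d -> exists v, [/\ nr v <= 1, perp n e v, nr (v - w) <= d & M - d < nr (x v)].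
  (* With [|x v| > M - d2] one has [M^2 - |x v|^2 <= 2 M d2 <= (M d / 2)^2], so [est] bounds
     [M^2 |v - M^-2 y (x v)|] by [M^2 d / 2]. The other half of [d] pays for replacing [x v] by the
     cluster point. *)
  move=> d0; pose d2 := Num.min d (M * d ^+ 2 / 8).
  have d20 : 0 < d2 by rewrite /d2 lt_min d0 divr_gt0// mulr_gt0// exprn_gt0.
  have [N NP] := invS_small d20.
  have B1 : 0 < B + 1 by rewrite ltr_wpDl.
  have [|k Nk /(_ 0 isT)] := gP N (M ^+ 2 * d / 2 / (B + 1)).
    by rewrite !divr_gt0// mulr_gt0.
  rewrite ltr_pdivlMr// => hg; have [v1 vp] := fP k.
  have kd : k.+1%:R^-1 < d2 by exact: NP.
  move=> hM; have {kd}hM : M - d2 < nr (x (f k)).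
    by apply: lt_trans hM; rewrite ltrD2l ltrN2.
  have dd : d2 <= d by rewrite /d2 ge_min lexx.
  have dd' : d2 <= M * d ^+ 2 / 8 by rewrite /d2 ge_min lexx orbT.
  exists (f k); split => //; last by lra.
  rewrite -(ler_pM2l M2) -[X in X * nr _]gtr0_norm// -nrZr scalerBr /w scalerA -rmorphM.
  rewrite mulfV ?gt_eqF// scale1r -(subrK (y (x (f k))) (_ *: f k)) -addrA.
  apply: le_trans (nrD _ _) _.
  have h1 : nr (y (x (f k)) - y (g 0)) <= M ^+ 2 * d / 2.
    rewrite -(lin_sub yl); apply: le_trans (yB _) _; have := nr_ge0 (x (f k) - g 0); lra.
  have h2 : nr ((M ^+ 2)%:C *: f k - y (x (f k))) <= M ^+ 2 * d / 2.
    have t0 : 0 <= M ^+ 2 * d / 2 by rewrite divr_ge0// mulr_ge0// ltW.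
    rewrite nr_distC -(@ler_pXn2r _ 2) ?nnegrE ?nr_ge0//.
    apply: le_trans (est _ vp v1) _.
    have -> : (M ^+ 2 * d / 2) ^+ 2 = M ^+ 2 * (M * 2 * (M * d ^+ 2 / 8)) by field.
    rewrite ler_pM2l//; apply: (@le_trans _ _ (M * 2 * d2)); last first.
      by rewrite ler_pM2l// mulr_gt0.
    move: (nr_ge0 (x (f k))) hM; move: (nr (x (f k))) => r r0 hM.
    have [Md|Md] := leP d2 M; last by have := sqr_ge0 r; nra.
    nra.
  by lra.
have w1 : nr w <= 1.
  apply: le_of_eps => d /near[v [v1 _ vw _]].
  have := nrB v (v - w); rewrite subKr; lra.
have wp : perp n e w.
  move=> i i_n; apply: (@cn_small_eq0 _ _ 1) => d /near[v [_ vp vw _]].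
  rewrite mul1r; apply: le_trans vw.
  have -> : ip w (e i) = ip (w - v) (e i) by rewrite ipBl vp// subr0.
  by apply: le_trans (cauchy_schwarz ip_norm _ _) _; rewrite (orthon_nr ip_norm on)// mulr1 nr_distC.
have xwM : M <= nr (x w).
  apply: le_of_eps => d d0; have B1 : 0 < B + 1 by rewrite ltr_wpDl.
  have [|v [_ _ vw xv]] := near (d / (B + 1)); first by rewrite divr_gt0.
  have := nrD (x w) (x (v - w)); rewrite -(lin_add xl) addrC subrK.
  have := xB (v - w); rewrite ler_pdivlMr// in vw.
  have : d / (B + 1) * (B + 1) = d by rewrite divfK// gt_eqF.
  move: xv (nr_ge0 (v - w)); move: (d / (B + 1)) => q; nra.
have w1' : nr w = 1.
  by apply/eqP; rewrite eq_le w1/= -(ler_pM2l Mp) mulr1; apply: le_trans (MP _ wp).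
have xwM' : nr (x w) = M.
  by apply/eqP; rewrite eq_le xwM andbT -[X in _ <= X]mulr1 -w1' MP.
exists w; split => //; rewrite xwM'//.
apply/eqP; rewrite -subr_eq0; apply/eqP/nr_eq0/eqP.
have := est _ wp w1; rewrite xwM' subrr mulr0 => h.
by rewrite -sqrf_eq0 eq_le h sqr_ge0.
Qed.

End SingularSystem.

(** * Operators of rank at most [n] *)

Section RankLe.
Context (R : realType) (H : completeNormedModType R[i]).

Definition rank_le (F : H -> H) n :=
  exists f : 'I_n -> H, forall v, exists c : 'I_n -> R[i], F v = \sum_j c j *: f j.

Lemma rank_leD (F G : H -> H) m n : rank_le F m -> rank_le G n -> rank_le (F \+ G) (m + n).
Proof.
move=> [f fP] [g gP].
exists (fun i => match fintype.split i with inl j => f j | inr j => g j end) => v.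
have [c cP] := fP v; have [d dP] := gP v.
exists (fun i => match fintype.split i with inl j => c j | inr j => d j end).
rewrite big_split_ord/= cP dP; congr (_ + _); apply: eq_bigr => i _.
  by rewrite (unsplitK (inl i)).
by rewrite (unsplitK (inr i)).
Qed.

Lemma rank_le_compr (F b : H -> H) n : rank_le F n -> rank_le (F \o b) n.
Proof. by move=> [f fP]; exists f => v; exact: fP. Qed.

Lemma rank_le_compl (F b : H -> H) n : linear b -> rank_le F n -> rank_le (b \o F) n.
Proof.
move=> bl [f fP]; exists (b \o f) => v; have [c cP] := fP v; exists c.
by rewrite /= cP (lin_sum bl); apply: eq_bigr => i _; rewrite (lin_scale bl).
Qed.

Lemma rank_le0 (F : H -> H) : (forall v, F v = 0) -> rank_le F 0.
Proof. by move=> F0; exists (fun=> 0) => v; exists (fun=> 0); rewrite big_ord0. Qed.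

Lemma rank_le1 (phi : H -> R[i]) (g : H) : rank_le (fun v => phi v *: g) 1.
Proof. by exists (fun=> g) => v; exists (fun=> phi v); rewrite big_ord1. Qed.

End RankLe.

(** * Singular systems and approximation numbers *)

Section SingularSystem.
Context (R : realType) (H : completeNormedModType R[i]) (ip : {dot H for Num.conj}).
Hypothesis ip_norm : inner_product_norm ip.
Hypothesis H_infinite : ~ finite_dim [set: H].
Local Notation perp := (perp ip).
Local Notation orthon := (orthon ip).
Local Notation adj := (adj ip).

(** Right singular vectors with their singular values. The last clause says that [s n] bounds [x] on
    the complement of the first [n] vectors; as [e n] lies there, the bound is attained. *)
Definition singular_system (x : H -> H) (e : nat -> H) (s : nat -> R) :=
  [/\ forall n, orthon n e, forall n, s n = nr (x (e n)),
      forall n, adj x (x (e n)) = (s n ^+ 2)%:C *: e n &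
      forall n v, perp n e v -> nr (x v) <= s n * nr v].

(** Maximal eigenvectors are chosen recursively, each in the complement of the earlier ones. *)
Lemma singular_system_exists x : compact_op x ->
  exists e, singular_system x e (fun n => nr (x (e n))).
Proof.
move=> xc; have xy := compact_adj ip_norm xc.
pose ok n (e : nat -> H) := orthon n e /\
  (forall i, (i < n)%N -> exists l, adj x (x (e i)) = l *: e i).
have /choice[g gP] : forall ne : nat * (nat -> H), exists w, ok ne.1 ne.2 ->
   [/\ nr w = 1, perp ne.1 ne.2 w, adj x (x w) = (nr (x w) ^+ 2)%:C *: w &
    forall v, perp ne.1 ne.2 v -> nr (x v) <= nr (x w) * nr v].
  move=> [n e]; have [nok|] := pselect (ok n e); last by exists 0.
  have [w wP] := max_eigenvector ip_norm H_infinite xc xy nok.1 nok.2.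
  by exists w.
(* [L n] carries the first [n] chosen vectors and is 0 beyond them. Later stages keep these entries,
   so the diagonal [e i = L i.+1 i] agrees with [L n] below [n]; this partial agreement is all that
   [okext] and [pext] ask for. *)
pose L := fix L n : nat -> H :=
  if n is n'.+1 then fun i => if i == n' then g (n', L n') else L n' i else fun=> 0.
pose e i := L i.+1 i.
have Le n i : (i < n)%N -> L n i = e i.
  elim: n => // n IH; rewrite ltnS leq_eqVlt => /predU1P[->//|i_n].
  by rewrite /= ltn_eqF// IH.
have eg n : e n = g (n, L n) by rewrite /e /= eqxx.
have okext n (e1 e2 : nat -> H) : (forall i, (i < n)%N -> e1 i = e2 i) -> ok n e1 -> ok n e2.
  move=> e12 [on ev]; split; first by move=> i j i_n jn; rewrite -!e12// on.
  by move=> i i_n; rewrite -e12//; exact: ev.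
have pext n (e1 e2 : nat -> H) v : (forall i, (i < n)%N -> e1 i = e2 i) -> perp n e1 v -> perp n e2 v.
  by move=> e12 p i i_n; rewrite -e12// p.
have main n : ok n e.
  elim: n => [|n [on ev]]; first by split.
  have okL : ok n (L n) by apply: okext (conj on ev) => i i_n; rewrite Le.
  have [w1 wp wT _] := gP (n, L n) okL; rewrite -eg /= in w1 wp wT.
  split; first by apply: orthonS => //; apply: pext wp => i; exact: Le.
  by move=> i; rewrite ltnS leq_eqVlt => /predU1P[->|/ev//]; eexists; exact: wT.
exists e; split=> //.
- by move=> n; have [] := main n.
- move=> n; have okL : ok n (L n) by apply: okext (main n) => i i_n; rewrite Le.
  by have [_ _ + _] := gP (n, L n) okL; rewrite -eg.
- move=> n v vp; have okL : ok n (L n) by apply: okext (main n) => i i_n; rewrite Le.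
  have [_ _ _ +] := gP (n, L n) okL; rewrite -eg; apply.
  by apply: pext vp => i i_n /=; rewrite Le.
Qed.

Section Facts.
Context (x : H -> H) (e : nat -> H) (s : nat -> R).
Hypothesis (xc : compact_op x) (sys : singular_system x e s).
Let xl : linear x. Proof. by case: xc. Qed.
Let on n : orthon n e. Proof. by case: sys. Qed.
Let sE n : s n = nr (x (e n)). Proof. by case: sys. Qed.
Let sT n : adj x (x (e n)) = (s n ^+ 2)%:C *: e n. Proof. by case: sys. Qed.
Let smax n v : perp n e v -> nr (x v) <= s n * nr v. Proof. by case: sys => _ _ _; exact. Qed.
Let xy := compact_adj ip_norm xc.

Lemma sys_ge0 n : 0 <= s n.
Proof. by rewrite sE nr_ge0. Qed.

Lemma sys_noninc : nonincreasing_seq s.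
Proof.
apply/nonincreasing_seqP => n; rewrite (sE n.+1).
have := @smax n (e n.+1); rewrite (orthon_nr ip_norm (@on n.+2))// mulr1; apply.
by move=> i i_n; rewrite (@on n.+2)//; [rewrite gtn_eqF//; exact: ltnW|exact: ltn_trans i_n _].
Qed.

Lemma sys_ip i j : ip (x (e i)) (x (e j)) = (s j ^+ 2)%:C * (i == j)%:R.
Proof.
by rewrite xy sT ipZr_real (@on (maxn i j).+1)// ltnS ?leq_maxl ?leq_maxr.
Qed.

(** If all [s n >= d], the vectors [x (e n)] are pairwise orthogonal of norm at least [d]. Their
    mutual distances are then at least [d] times the square root of 2, which excludes a cluster
    point. *)
Lemma sys_to0 (d : R) : 0 < d -> exists n, s n < d.
Proof.
move=> d0; apply: contrapT => /forallNP h.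
have sd n : d <= s n by rewrite leNgt; exact/negP.
have [|g gP] := compact_cluster (N := 1) (f := fun _ => e) xc ltr01.
  by move=> _ k _; rewrite (orthon_nr ip_norm (@on k.+1)).
have d20 : 0 < d / 2 by lra.
have [k _ /(_ 0 isT) hk] := gP 0 (d / 2) d20.
have [l kl /(_ 0 isT) hl] := gP k.+1 (d / 2) d20.
have := nrB_sq ip_norm (x (e k)) (x (e l)).
rewrite sys_ip ltn_eqF// mulr0/= mulr0 subr0 -!sE.
have : nr (x (e k) - x (e l)) < d.
  rewrite -(subrKA (g 0)); apply: le_lt_trans (nrD _ _) _.
  by rewrite [nr (g 0 - _)]nr_distC; lra.
have := nr_ge0 (x (e k) - x (e l)); have := sd k; have := sd l; nra.
Qed.

(** Eigenvectors of a self-adjoint operator for distinct eigenvalues are orthogonal; nonnegativity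
    makes the squares of [s n] and [t] distinct. *)
Lemma sys_eigen_coord (t : R) v n : adj x (x v) = (t ^+ 2)%:C *: v -> 0 <= t ->
  s n != t -> ip v (e n) = 0.
Proof.
move=> vT t0 snt; have : ip (adj x (x v)) (e n) = ip v (adj x (x (e n))).
  by rewrite ipC -xy ipC conjcK xy.
rewrite vT sT ipZl ipZr_real => /eqP.
rewrite -subr_eq0 -mulrBl mulf_eq0 => /orP[|/eqP//].
rewrite -rmorphB => /eqP/complexI/eqP; rewrite subr_eq0 eqrXn2 ?sys_ge0//.
by rewrite eq_sym (negPf snt).
Qed.

(** A value [t > 0] is taken exactly on an interval [p <= n < q], bounded since [s] tends to 0, and
    the vectors [e n] with these indices form a basis of the eigenspace of [t ^ 2]. *)
Lemma sys_singular_values : is_singular_values ip x s.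
Proof.
split; [exact: sys_ge0|exact: sys_noninc|] => t t0.
have ex1 : exists n, s n <= t by have [n /ltW ?] := sys_to0 t0; exists n.
have ex2 := sys_to0 t0.
have [p pt pmin] := ex_minnP ex1; have [q qt qmin] := ex_minnP ex2.
have ltE n : (s n < t) = (q <= n)%N.
  apply/idP/idP; first exact: qmin.
  by move=> /sys_noninc h; exact: le_lt_trans h qt.
have leE n : (s n <= t) = (p <= n)%N.
  apply/idP/idP; first exact: pmin.
  by move=> /sys_noninc h; exact: le_trans h pt.
have eqE n : (s n == t) = (p <= n < q)%N.
  by rewrite eq_le leE leNgt ltE -ltnNge.
exists (q - p)%N, (fun i => e (p + i)%N); split; last first.
  have -> : [set n | s n = t] = `I_q `\` `I_p.
    apply/seteqP; split => [n /= /eqP|n /= [nq /negP]].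
      by rewrite eqE => /andP[pn nq]; split => //; apply/negP; rewrite -leqNgt.
    by rewrite -leqNgt => pn; apply/eqP; rewrite eqE pn.
  exact: card_IID.
have inpq (i : 'I_(q - p)) : s (p + i)%N = t.
  by apply/eqP; rewrite eqE leq_addr/= -ltn_subRL ltn_ord.
have onp : orthon (q - p) (fun i => e (p + i)%N).
  move=> i j i_n jn; rewrite (@on ((p + maxn i j).+1)) ?eqn_add2l//.
    by rewrite ltnS leq_add2l leq_maxl.
  by rewrite ltnS leq_add2l leq_maxr.
split.
- by move=> i; rewrite /eigenspace_of/= sT inpq.
- move=> v vT; exists (fun i => ip v (e (p + i)%N)).
  set e' := (fun i => e (p + i)%N) in onp.
  rewrite -/(proj ip (q - p) e' v); set w := proj ip _ _ _.
  apply/eqP; rewrite -subr_eq0; apply/eqP/nr_eq0.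
  set r := v - w.
  have yl := is_adj_linear ip_norm xy.
  have Tl : linear (adj x \o x) by move=> c u z /=; rewrite xl yl.
  have rT : adj x (x r) = (t ^+ 2)%:C *: r.
    rewrite (_ : adj x (x r) = adj x (x v) - adj x (x w)); last exact: (lin_sub Tl v w).
    rewrite scalerBr; congr (_ - _); first exact: vT.
    transitivity (\sum_(i < q - p) (adj x \o x) (ip v (e' i) *: e' i)).
      exact: (lin_sum Tl).
    rewrite scaler_sumr; apply: eq_bigr => i _.
    by rewrite (lin_scale Tl) /= /e' sT inpq !scalerA mulrC.
  have rp n : perp n e r.
    move=> i _; have [sit|] := eqVneq (s i) t; last exact: sys_eigen_coord (ltW t0).
    move/eqP: sit; rewrite eqE => /andP[pi iq].
    have ipq : (i - p < q - p)%N by rewrite ltn_sub2r// (leq_ltn_trans pi).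
    by have := perp_proj v onp ipq; rewrite /e' subnKC.
  have xr : nr (x r) = t * nr r.
    apply/eqP; rewrite -(@eqrXn2 _ 2) ?mulr_ge0 ?nr_ge0// ?(ltW t0)//.
    by rewrite (nr_sq ip_norm) xy rT ipZr_real (ipvv ip_norm) -rmorphM exprMn.
  (* The remainder [r] is orthogonal to every [e n], so [t |r| = |x r| <= s n |r|] with [s n < t]
     forces [r = 0]. *)
  have [n nt] := ex2.
  have := smax (rp n); rewrite xr => h.
  by apply/eqP; rewrite eq_le nr_ge0 andbT; have := nr_ge0 r; nra.
- by move=> c; exact: (orthon_free onp).
Qed.

(** The best approximant is [x] composed with the projection on the first [n] singular vectors. *)
Lemma sys_upper n : exists2 F, rank_le F n & linear F /\ forall v, nr (x v - F v) <= s n * nr v.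
Proof.
exists (fun v => x (proj ip n e v)).
  exists (fun i => x (e i)) => v; exists (fun i => ip v (e i)).
  by rewrite /proj (lin_sum xl); apply: eq_bigr => i _; rewrite (lin_scale xl).
split.
  move=> c u v; rewrite -xl /proj; congr (x _).
  rewrite scaler_sumr -big_split; apply: eq_bigr => i _.
  by rewrite ipDl ipZl scalerDl scalerA.
move=> v; rewrite -(lin_sub xl); apply: le_trans (smax (perp_proj v (@on n))) _.
by rewrite ler_wpM2l ?sys_ge0// (nrB_proj_le ip_norm).
Qed.

(** An operator of rank at most [n] kills a nonzero combination [v] of the [n + 1] vectors [e 0],
    ..., [e n], and [|x v| >= s n |v|] on their span. *)
Lemma sys_lower n F (c : R) : rank_le F n -> linear F ->
  (forall v, nr (x v - F v) <= c * nr v) -> s n <= c.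
Proof.
move=> [f fP] Fl Fc.
have gf (i : 'I_n.+1) : exists c : 'I_n -> R[i], F (e i) = \sum_j c j *: f j by exact: fP.
have [d [k dk] dF] := span_dependent (ltnSn n) gf.
pose v := \sum_i d i *: e i.
have Fv : F v = 0.
  by rewrite /v (lin_sum Fl) -[RHS]dF; apply: eq_bigr => i _; rewrite (lin_scale Fl).
have v0 : v <> 0 by move=> v0; move: dk; rewrite (orthon_free (@on n.+1) v0) eqxx.
have vn := nr_gt0 v0.
have := Fc v; rewrite Fv subr0 => xvc.
suff : s n * nr v <= nr (x v) by move=> h; rewrite -(ler_pM2r vn); exact: le_trans h xvc.
rewrite -(@ler_pXn2r _ 2) ?nnegrE ?mulr_ge0 ?nr_ge0 ?sys_ge0//.
rewrite exprMn.
have -> : nr v ^+ 2 = \sum_i cn (d i) ^+ 2.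
  apply: complexI; rewrite -(ipvv ip_norm) {2}/v ip_sumr rmorph_sum/=; apply: eq_bigr => i _.
  by rewrite ipZr (ip_lin_comb d i (@on n.+1)) mulrC cn_sq.
have xvE : x v = \sum_i d i *: x (e i).
  by rewrite (lin_sum xl); apply: eq_bigr => i _; rewrite (lin_scale xl).
have -> : nr (x v) ^+ 2 = \sum_(i < n.+1) s i ^+ 2 * cn (d i) ^+ 2.
  apply: complexI; rewrite -(ipvv ip_norm) {2}xvE ip_sumr rmorph_sum/=.
  apply: eq_bigr => i _; rewrite ipZr xy sT ipZr_real.
  by rewrite (ip_lin_comb d i (@on n.+1)) mulrCA [RHS]rmorphM/= -cn_sq [d i * _]mulrC.
rewrite mulr_sumr; apply: ler_sum => i _; rewrite ler_wpM2r ?sqr_ge0//.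
by rewrite ler_pXn2r ?nnegrE ?sys_ge0// sys_noninc// -ltnS.
Qed.

End Facts.

End SingularSystem.

(** * Inequalities for singular values *)

Section SingularValues.
Context (R : realType) (H : completeNormedModType R[i]) (ip : {dot H for Num.conj}).
Hypothesis ip_norm : inner_product_norm ip.
Hypothesis H_infinite : ~ finite_dim [set: H].
Local Notation sv := (singular_values ip).

Lemma basis_size (E : set H) m n (e : 'I_m -> H) (f : 'I_n -> H) :
  is_basis E e -> is_basis E f -> m = n.
Proof.
suff le p q (e' : 'I_p -> H) (f' : 'I_q -> H) : is_basis E e' -> is_basis E f' -> (p <= q)%N.
  by move=> he hf; apply/eqP; rewrite eqn_leq (le _ _ _ _ he hf) (le _ _ _ _ hf he).
move=> [e1 _ efree] [_ fspan _]; rewrite leqNgt; apply/negP => qp.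
have [c [i ci] c0] := span_dependent qp (fun i => fspan _ (e1 i)).
by move: ci; rewrite (efree c c0) eqxx.
Qed.

(* At the first index where two candidate sequences differ, the larger of the
   two values has different multiplicities in the two sequences. *)
Lemma singular_values_unique x s s' : is_singular_values ip x s ->
  is_singular_values ip x s' -> s = s'.
Proof.
suff lt_false u u' n : is_singular_values ip x u -> is_singular_values ip x u' ->
    (forall k, (k < n)%N -> u k = u' k) -> ~ (u n < u' n).
  move=> hs hs'; apply/funext => n.
  elim/ltn_ind: n => n IH; apply/eqP; rewrite eq_le !leNgt; apply/andP; split; apply/negP.
    by apply: (lt_false _ _ n hs' hs) => k /IH.
  exact: (lt_false _ _ n hs hs').
move=> [u0 udec uE] [u0' udec' uE'] uu' unt; set t := u' n in unt.
have t0 : 0 < t by exact: le_lt_trans unt.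
have [m [e [eb em]]] := uE t t0; have [m' [e' [eb' em']]] := uE' t t0.
have mm := basis_size eb eb'; rewrite -{}mm in em' => {eb eb' e e' m'}.
have exp : exists k, u' k <= t by exists n.
have [p pt pmin] := ex_minnP exp.
have pn : (p <= n)%N by exact: pmin.
have leE k : (u' k <= t) = (p <= k)%N.
  apply/idP/idP; first exact: pmin.
  by move=> /udec' h; exact: le_trans h pt.
have E1 : [set k | u k = t] = `I_n `\` `I_p.
  apply/seteqP; split => [k /= ukt|k /= [kn /negP]].
    have kn : (k < n)%N by rewrite ltnNge; apply/negP => /udec; rewrite leNgt ukt unt.
    by split => //; apply/negP; rewrite -leqNgt -leE -uu'// ukt.
  rewrite -leqNgt -leE uu'// => ut; apply/eqP; rewrite eq_le ut.
  by apply: udec'; exact: ltnW.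
have : (`I_n.+1 `\` `I_p #<= `I_n `\` `I_p)%card.
  rewrite -E1 (card_le_eqr em) -(card_le_eqr em'); apply: subset_card_le => k /= [kn /negP].
  rewrite -leqNgt -leE => ut; apply/eqP; rewrite eq_le ut; exact: udec'.
rewrite (card_le_eql card_IID) (card_le_eqr card_IID) card_le_II.
by rewrite subSn// ltnn.
Qed.

(** Uniqueness identifies the sequence picked by [xget] with that of a constructed system, so the
    default value does not occur. *)
Lemma sv_system x : compact_op x -> exists e, singular_system ip x e (sv x).
Proof.
move=> xc; have [e sys] := singular_system_exists ip_norm H_infinite xc.
exists e; suff -> : sv x = (fun n => nr (x (e n))) by [].
have xs := sys_singular_values ip_norm xc sys.
rewrite /singular_values; case: xgetP => [s _ hs|/(_ _ xs)//].
exact: singular_values_unique hs xs.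
Qed.

Section Compact.
Context (x : H -> H) (xc : compact_op x).

Lemma sv_ge0 n : 0 <= sv x n.
Proof. by have [e sys] := sv_system xc; exact: sys_ge0 sys n. Qed.

Lemma sv_noninc : nonincreasing_seq (sv x).
Proof. by have [e sys] := sv_system xc; exact: sys_noninc sys. Qed.

Lemma sv_upper n :
  exists2 F, rank_le F n & linear F /\ forall v, nr (x v - F v) <= sv x n * nr v.
Proof. by have [e sys] := sv_system xc; exact: (sys_upper ip_norm xc sys). Qed.

Lemma sv_lower n F c : rank_le F n -> linear F ->
  (forall v, nr (x v - F v) <= c * nr v) -> sv x n <= c.
Proof. by have [e sys] := sv_system xc; exact: (sys_lower ip_norm xc sys). Qed.

Lemma sv_bound v : nr (x v) <= sv x 0 * nr v.
Proof. by have [e [_ _ _ h]] := sv_system xc; apply: h. Qed.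

Lemma sv_le_bound n c : (forall v, nr (x v) <= c * nr v) -> sv x n <= c.
Proof.
move=> xB; apply: (@le_trans _ _ (sv x 0)); first exact: sv_noninc.
apply: (@sv_lower 0 (fun=> 0)); first exact: rank_le0.
  by move=> d u v; rewrite scaler0 addr0.
by move=> v; rewrite subr0.
Qed.

Lemma sv_rank n k : rank_le x n -> (n <= k)%N -> sv x k = 0.
Proof.
move=> xn nk; apply/eqP; rewrite eq_le sv_ge0 andbT.
apply: le_trans (sv_noninc nk) _; apply: sv_lower xn (proj1 xc) _ => v.
by rewrite subrr nr0 mul0r.
Qed.

(** If [F] approximates [x] with rank at most [n], then [b \o F \o c] approximates [b \o x \o c]
    with the error multiplied by [B * C]. *)
Lemma sv_comp (b c : H -> H) (B C : R) n : linear b -> linear c -> 0 <= B -> 0 <= C ->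
  (forall v, nr (b v) <= B * nr v) -> (forall v, nr (c v) <= C * nr v) ->
  compact_op (b \o x \o c) -> sv (b \o x \o c) n <= B * C * sv x n.
Proof.
move=> bl cl B0 C0 bB cC bxc.
have [F Fr [Fl Fx]] := sv_upper n.
have [e sys] := sv_system bxc.
apply: (sys_lower ip_norm bxc sys (F := b \o F \o c)).
- exact: rank_le_compr (rank_le_compl bl Fr).
- by move=> d u v; rewrite /= cl Fl bl.
move=> v; rewrite /= -(lin_sub bl); apply: le_trans (bB _) _.
rewrite -!mulrA ler_wpM2l//; apply: le_trans (Fx _) _.
rewrite mulrCA ler_wpM2l ?sv_ge0//.
Qed.

End Compact.

Lemma svD x y m n : compact_op x -> compact_op y ->
  sv (x \+ y) (m + n) <= sv x m + sv y n.
Proof.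
move=> xc yc; have [F Fr [Fl Fx]] := sv_upper xc m; have [G Gr [Gl Gy]] := sv_upper yc n.
apply: (sv_lower (compact_opD xc yc) (rank_leD Fr Gr)).
  by move=> d u v /=; rewrite Fl Gl scalerDr addrACA.
move=> v /=; rewrite opprD addrACA mulrDl.
exact: le_trans (nrD _ _) (lerD (Fx v) (Gy v)).
Qed.

End SingularValues.

(** * Symmetric norms and the ideal *)

Section SymmetricNorm.
Context (R : realType) (Phi : R^nat -> R) (snf : symmetric_norming Phi).

Definition trunc (s : R^nat) n : R^nat := fun k => if (k < n)%N then s k else 0.

Lemma padE (s : R^nat) n : pad (fun i : 'I_n => s i) = trunc s n.
Proof.
apply/funext => k; rewrite /pad /trunc; case: insubP => [i -> <-//|].
by move=> /negPf ->.
Qed.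

Lemma pad_tnth n (t : n.-tuple R) : pad (tnth t) = nth 0 t.
Proof.
rewrite (_ : tnth t = fun i : 'I_n => nth 0 t i); last by apply/funext => i; rewrite (tnth_nth 0).
rewrite padE; apply/funext => k; rewrite /trunc; case: ltnP => // nk.
by rewrite nth_default// size_tuple.
Qed.

Lemma nth_mkseq_trunc (s : R^nat) n : nth 0 (mkseq s n) = trunc s n.
Proof.
apply/funext => k; rewrite /trunc; case: ltnP => nk; first by rewrite nth_mkseq.
by rewrite nth_default// size_mkseq.
Qed.

Lemma trunc_supp s n : finitely_supported (trunc s n).
Proof.
by exists n => // k /= nk; rewrite /trunc ltnNge nk.
Qed.

Lemma snf_abs s n : Phi (trunc s n) = Phi (trunc (fun k => `|s k|) n).
Proof.
rewrite -!padE (snf_symmetric snf _ 1%g); congr (Phi (pad _)).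
by apply/funext => i; rewrite perm1.
Qed.

(** The symmetry axiom inserts absolute values, so it is applied on both sides, with the identity on
    one and the permutation on the other. *)
Lemma snf_perm (l l' : seq R) : perm_eq l l' -> Phi (nth 0 l) = Phi (nth 0 l').
Proof.
move=> ll'; have sl := perm_size ll'.
have /tuple_permP[p lp] : perm_eq l (tcast (esym sl) (in_tuple l')).
  by rewrite val_tcast.
have -> : nth 0 l' = pad (tnth (tcast (esym sl) (in_tuple l'))) by rewrite pad_tnth val_tcast.
have -> : nth 0 l = pad (tnth (in_tuple l)) by rewrite pad_tnth.
rewrite (snf_symmetric snf _ 1%g) [RHS](snf_symmetric snf _ p); congr (Phi (pad _)).
apply/funext => i; rewrite perm1; congr (`| _ |).
rewrite (tnth_nth 0) /= {1}lp -tnth_nth tnth_mktuple//.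
Qed.

(** Entries of [t] are replaced by those of [s] one at a time. If [s j = c * t j] with [|c| <= 1],
    the new sequence is the convex combination, with weights [(1 + c) / 2] and [(1 - c) / 2], of the
    old one and its copy with entry [j] negated, which has the same [Phi]. *)
Lemma snf_mono s t n : (forall k, (k < n)%N -> `|s k| <= t k) ->
  Phi (trunc s n) <= Phi (trunc t n).
Proof.
move=> st; pose h j k := if (k < j)%N then s k else t k.
suff step j : Phi (trunc (h j) n) <= Phi (trunc t n).
  apply: le_trans (step n); rewrite le_eqVlt; apply/orP; left; apply/eqP; congr Phi.
  by apply/funext => k; rewrite /trunc /h; case: ifP.
elim: j => [|j IH]; first by rewrite (_ : h 0 = t)//; apply/funext => k.
apply: le_trans IH; have [nj|jn] := leqP n j.
  rewrite le_eqVlt; apply/orP; left; apply/eqP; congr Phi.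
  apply/funext => k; rewrite /trunc /h; case: ifP => // kn.
  by rewrite ltnS (ltnW (leq_trans kn nj)) (leq_trans kn nj).
have sj := st j jn.
(* When [t j = 0] also [s j = 0], and the convention for division by zero gives [c = 0]. *)
pose c := s j / t j.
have ctj : c * t j = s j.
  have [t0|tn0] := eqVneq (t j) 0; last by rewrite /c divfK.
  by move: sj; rewrite t0 normr_le0 => /eqP ->; rewrite mulr0.
have c1 : `|c| <= 1.
  have [t0|tn0] := eqVneq (t j) 0; first by rewrite /c t0 invr0 mulr0 normr0.
  have tp : 0 < t j by rewrite lt_def tn0 (le_trans _ sj).
  by rewrite /c normrM normfV (gtr0_norm tp) ler_pdivrMr// mul1r.
pose fl k := if k == j then - h j k else h j k.
have flE : Phi (trunc fl n) = Phi (trunc (h j) n).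
  rewrite snf_abs [RHS]snf_abs; congr (Phi (trunc _ n)); apply/funext => k.
  by rewrite /fl; case: ifP; rewrite ?normrN.
have -> : trunc (h j.+1) n = ((1 + c) / 2) \*o trunc (h j) n \+ ((1 - c) / 2) \*o trunc fl n.
  apply/funext => k; rewrite /trunc /=; case: ifP => [kn|]; last by rewrite !mulr0 addr0.
  rewrite /fl /h ltnS; have [->|kj] := eqVneq k j.
    by rewrite leqnn ltnn -ctj; field.
  by rewrite leq_eqVlt (negPf kj)/=; case: ifP => _; field.
move: c1; rewrite ler_norml => /andP[c1 c2].
apply: le_trans (snf_triangle snf _ _) _.
- by exists n => // k /= nk; rewrite /trunc ltnNge nk/= mulr0.
- by exists n => // k /= nk; rewrite /trunc ltnNge nk/= mulr0.
rewrite !(snf_scale snf)//; [|exact: trunc_supp|exact: trunc_supp].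
rewrite flE -mulrDl !ger0_norm ?divr_ge0//; [|lra|lra].
by rewrite le_eqVlt; apply/orP; left; apply/eqP; field.
Qed.

Lemma snf_unit_at i : Phi (fun k => (k == i)%:R) = 1.
Proof.
rewrite -[RHS](snf_unit snf).
have -> : (fun k => (k == i)%:R) = nth 0 (nseq i 0 ++ [:: 1]) :> (nat -> R).
  apply/funext => k; rewrite nth_cat size_nseq nth_nseq.
  case: (ltngtP k i) => [//|ik|->]; last by rewrite subnn.
  by rewrite nth_default//= subn_gt0.
have -> : (fun k => (k == 0)%:R) = nth 0 ([:: 1] ++ nseq i 0) :> (nat -> R).
  by apply/funext => -[|k]//=; rewrite nth_nseq; case: ifP.
by apply: snf_perm; rewrite perm_catC.
Qed.

Lemma snf_le_sum s n : Phi (trunc s n) <= \sum_(i < n) `|s i|.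
Proof.
elim: n => [|n IH].
  have -> : trunc s 0 = 0 \*o trunc s 0 by apply/funext => k; rewrite /trunc /= mulr0.
  by rewrite (snf_scale snf)//; [rewrite normr0 mul0r big_ord0|exact: trunc_supp].
have -> : trunc s n.+1 = trunc s n \+ s n \*o (fun k => (k == n)%:R).
  apply/funext => k; rewrite /trunc /= ltnS; case: ltngtP => kn.
  - by rewrite mulr0 addr0.
  - by rewrite mulr0 addr0.
  - by rewrite kn mulr1 add0r.
have us : finitely_supported (fun k => (k == n)%:R : R).
  by exists n.+1 => // k /= nk; rewrite gtn_eqF.
rewrite big_ord_recr/=; apply: le_trans (snf_triangle snf _ _) _.
- exact: trunc_supp.
- by exists n.+1 => // k /= nk; rewrite gtn_eqF// mulr0.
by rewrite (snf_scale snf)// snf_unit_at mulr1 lerD2r.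
Qed.

Lemma snf_rank s r n (c : R) : (forall k, `|s k| <= c) ->
  (forall k, (r <= k)%N -> s k = 0) -> Phi (trunc s n) <= r%:R * c.
Proof.
move=> sc sr; have -> : trunc s n = trunc s (minn n r).
  apply/funext => k; rewrite /trunc leq_min; case: ltnP => //= _.
  by case: ltnP => // /sr ->.
apply: le_trans (snf_le_sum _ _) _.
apply: (@le_trans _ _ (\sum_(i < minn n r) c)); first by apply: ler_sum => i _.
have c0 : 0 <= c by exact: le_trans (sc 0).
by rewrite sumr_const card_ord -[leLHS]mulr_natl ler_wpM2r// ler_nat geq_minr.
Qed.

Lemma snf_head s n : (0 < n)%N -> (forall k, 0 <= s k) -> s 0 <= Phi (trunc s n).
Proof.
move=> n0 s0; have us : finitely_supported (fun k => (k == 0)%:R : R).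
  by exists 1 => // k /= nk; rewrite gtn_eqF.
have <- : Phi (trunc (fun k => s 0 * (k == 0)%:R) n) = s 0.
  transitivity (`|s 0| * Phi (fun k => (k == 0)%:R)); last first.
    by rewrite (snf_unit snf) mulr1 ger0_norm.
  rewrite -(snf_scale snf)//; congr Phi.
  by apply/funext => -[|k]; rewrite /trunc /= ?n0//; case: ifP; rewrite ?mulr0.
apply: snf_mono => -[|k] _ /=; first by rewrite mulr1 ger0_norm.
by rewrite mulr0 normr0.
Qed.

(** The even and the odd positions of the doubled sequence each carry a rearrangement of the first
    [k] entries of [s] and [k] zeros; the triangle inequality adds the two. *)
Lemma snf_double s k : Phi (trunc (fun i => s i./2) k.*2) <= 2 * Phi (trunc s k).
Proof.
have evenP : Phi (trunc (fun i => if odd i then 0 else s i./2) k.*2) = Phi (trunc s k).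
  rewrite -!nth_mkseq_trunc.
  have -> : nth 0 (mkseq s k) = nth 0 (mkseq s k ++ nseq k 0).
    apply/funext => i; rewrite nth_cat size_mkseq nth_nseq if_same; case: ltnP => // ki.
    by rewrite nth_default// size_mkseq.
  apply: snf_perm; apply/seq.permP => P; elim: k => // k IH.
  move: IH; rewrite doubleS !mkseqS -!cats1 !count_cat/= odd_double/= doubleK => ->.
  lia.
have oddP : Phi (trunc (fun i => if odd i then s i./2 else 0) k.*2) = Phi (trunc s k).
  rewrite -!nth_mkseq_trunc.
  have -> : nth 0 (mkseq s k) = nth 0 (mkseq s k ++ nseq k 0).
    apply/funext => i; rewrite nth_cat size_mkseq nth_nseq if_same; case: ltnP => // ki.
    by rewrite nth_default// size_mkseq.
  apply: snf_perm; apply/seq.permP => P; elim: k {evenP} => // k IH.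
  move: IH; rewrite doubleS !mkseqS -!cats1 !count_cat/= odd_double/= uphalf_double => ->.
  lia.
have -> : trunc (fun i => s i./2) k.*2 =
    trunc (fun i => if odd i then 0 else s i./2) k.*2 \+
    trunc (fun i => if odd i then s i./2 else 0) k.*2.
  apply/funext => i; rewrite /trunc /=; case: ifP => _; last by rewrite addr0.
  by case: ifP; rewrite ?addr0 ?add0r.
apply: le_trans (snf_triangle snf _ _) _; [exact: trunc_supp|exact: trunc_supp|].
by rewrite evenP oddP mulr2n mulrDl mul1r.
Qed.

End SymmetricNorm.

(** * The Phi-norm of operators and the ideal *)

Section NormPhi.
Context (R : realType) (H : completeNormedModType R[i]) (ip : {dot H for Num.conj}).
Hypothesis ip_norm : inner_product_norm ip.
Hypothesis H_infinite : ~ finite_dim [set: H].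
Context (Phi : R^nat -> R) (snf : symmetric_norming Phi).
Local Notation sv := (singular_values ip).
Local Notation normPhi := (normPhi ip Phi).
Local Notation idealPhi := (idealPhi ip Phi).

Lemma normPhi_leP x (c : R) : (normPhi x <= c%:E)%E <->
  forall k, (0 < k)%N -> Phi (trunc (sv x) k) <= c.
Proof.
split=> [xc k k0|xc].
  rewrite -lee_fin; apply: le_trans xc; apply: ereal_sup_ubound.
  by exists k => //; rewrite padE.
by apply: ge_ereal_sup => _ [k k0 <-]; rewrite padE lee_fin; exact: xc.
Qed.

Lemma normPhi_lty x : (normPhi x < +oo)%E <-> exists c : R, (normPhi x <= c%:E)%E.
Proof.
split=> [|[c xc]]; last exact: le_lt_trans xc (ltry c).
case E : (normPhi x) => [r| |]// _; [by exists r|by exists 0; rewrite leNye].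
Qed.

(** The Phi-norm dominates the operator norm, since it dominates the first singular value. *)
Lemma normPhi_bound x (c : R) : compact_op x -> (normPhi x <= c%:E)%E ->
  forall v, nr (x v) <= c * nr v.
Proof.
move=> xc /normPhi_leP/(_ 1%N isT) h v.
apply: le_trans (sv_bound ip_norm H_infinite xc v) _.
rewrite ler_wpM2r ?nr_ge0//; apply: le_trans h.
by apply: snf_head => // k; apply: sv_ge0.
Qed.

Lemma normPhiD x y (c d : R) : compact_op x -> compact_op y ->
  (normPhi x <= c%:E)%E -> (normPhi y <= d%:E)%E -> (normPhi (x \+ y)%R <= (2 * (c + d))%:E)%E.
Proof.
move=> xc yc /normPhi_leP hx /normPhi_leP hy; apply/normPhi_leP => k k0.
have xyc := compact_opD xc yc.
pose t i := sv x i + sv y i.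
have svt i : sv (x \+ y) i <= t i./2.
  apply: le_trans (svD ip_norm H_infinite _ _ xc yc).
  have h : (i./2 + i./2 <= i)%N by lia.
  exact: (sv_noninc ip_norm H_infinite xyc h).
apply: (@le_trans _ _ (Phi (trunc (fun i => t i./2) k.*2))).
  (* Filled up with zeros to length [k.*2], the first [k] singular values can be compared entrywise
     with the doubled sequence. *)
  apply: (@le_trans _ _ (Phi (trunc (trunc (sv (x \+ y)) k) k.*2))).
    rewrite le_eqVlt; apply/orP; left; apply/eqP; congr Phi; apply/funext => i.
    rewrite /trunc; case: ifP => ik; case: ifP => //.
    by rewrite -addnn ltn_addl.
  apply: snf_mono => // i _; rewrite /trunc; case: ifP => _; last first.
    by rewrite normr0 addr_ge0//; apply: sv_ge0.
  by rewrite ger0_norm//; apply: sv_ge0.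
apply: le_trans (snf_double snf _ _) _; rewrite ler_pM2l//.
have -> : trunc t k = trunc (sv x) k \+ trunc (sv y) k.
  by apply/funext => i; rewrite /trunc /=; case: ifP => _; rewrite ?addr0.
apply: le_trans (snf_triangle snf _ _) (lerD (hx _ k0) (hy _ k0)); exact: trunc_supp.
Qed.

Lemma normPhi_comp x (b c : H -> H) (B C r : R) : compact_op x -> linear b -> linear c ->
  0 <= B -> 0 <= C -> (forall v, nr (b v) <= B * nr v) -> (forall v, nr (c v) <= C * nr v) ->
  (normPhi x <= r%:E)%E ->
  compact_op (b \o x \o c) /\ (normPhi (b \o x \o c) <= (B * C * r)%:E)%E.
Proof.
move=> xc bl cl B0 C0 bB cC /normPhi_leP hx.
have bxc : compact_op (b \o x \o c).
  by apply: compact_op_compr cl cC; apply: compact_op_compl bl bB.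
split => //; apply/normPhi_leP => k k0.
have BC0 : 0 <= B * C by rewrite mulr_ge0.
apply: (@le_trans _ _ (Phi (trunc (fun i => B * C * sv x i) k))).
  apply: snf_mono => // i _; rewrite ger0_norm; last by apply: sv_ge0.
  exact: (sv_comp ip_norm H_infinite xc).
have -> : trunc (fun i => B * C * sv x i) k = (B * C) \*o trunc (sv x) k.
  by apply/funext => i; rewrite /trunc /=; case: ifP => //; rewrite mulr0.
rewrite (snf_scale snf); last exact: trunc_supp.
by rewrite ger0_norm// ler_wpM2l// hx.
Qed.

(** At most [n] singular values are nonzero, each at most [c]. For bounded rank, operator-norm
    smallness therefore gives Phi-norm smallness. *)
Lemma normPhi_rank x n (c : R) : compact_op x -> rank_le x n ->
  (forall v, nr (x v) <= c * nr v) -> (normPhi x <= (n%:R * c)%:E)%E.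
Proof.
move=> xc xn xB; apply/normPhi_leP => k _; apply: snf_rank => // i.
  rewrite ger0_norm; last by apply: sv_ge0.
  exact: (sv_le_bound ip_norm H_infinite xc).
exact: (sv_rank ip_norm H_infinite xc).
Qed.

Lemma ideal_bound x : idealPhi x -> exists c : R, (normPhi x <= c%:E)%E.
Proof. by case=> _ /normPhi_lty. Qed.

Lemma idealD x y : idealPhi x -> idealPhi y -> idealPhi (x \+ y).
Proof.
move=> [xc /normPhi_lty[c hx]] [yc /normPhi_lty[d hy]]; split; first exact: compact_opD.
by apply/normPhi_lty; exists (2 * (c + d)); exact: normPhiD.
Qed.

Lemma ideal_comp x (b c : H -> H) (B C : R) : idealPhi x -> linear b -> linear c ->
  0 <= B -> 0 <= C -> (forall v, nr (b v) <= B * nr v) -> (forall v, nr (c v) <= C * nr v) ->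
  idealPhi (b \o x \o c).
Proof.
move=> [xc /normPhi_lty[r hx]] bl cl B0 C0 bB cC.
have [h1 h2] := normPhi_comp xc bl cl B0 C0 bB cC hx.
by split => //; apply/normPhi_lty; eexists; exact: h2.
Qed.

Lemma ideal_rank x n (c : R) : compact_op x -> rank_le x n ->
  (forall v, nr (x v) <= c * nr v) -> idealPhi x.
Proof.
move=> xc xn xB; split => //; apply/normPhi_lty.
by exists (n%:R * c); exact: normPhi_rank xB.
Qed.

Lemma opp_linear : linear (fun v : H => - v).
Proof. by move=> c u v; rewrite scalerN opprD. Qed.

Lemma id_linear : linear (fun v : H => v).
Proof. by []. Qed.

Lemma nr_opp_le (v : H) : nr (- v) <= 1 * nr v.
Proof. by rewrite nrN mul1r. Qed.

Lemma nr_id_le (v : H) : nr v <= 1 * nr v.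
Proof. by rewrite mul1r. Qed.

Lemma normPhiN x (r : R) : compact_op x -> (normPhi x <= r%:E)%E ->
  compact_op (fun v => - x v) /\ (normPhi (fun v => - x v)%R <= r%:E)%E.
Proof.
move=> xc hx.
have := normPhi_comp xc opp_linear id_linear ler01 ler01 nr_opp_le nr_id_le hx.
by rewrite mul1r mul1r.
Qed.

Lemma idealN x : idealPhi x -> idealPhi (fun v => - x v).
Proof.
move=> [xc /normPhi_lty[r hx]]; have [h1 h2] := normPhiN xc hx.
by split => //; apply/normPhi_lty; exists r.
Qed.

Lemma idealB x y : idealPhi x -> idealPhi y -> idealPhi (x \- y).
Proof. by move=> xI /idealN yI; exact: (idealD xI yI). Qed.

End NormPhi.

(** * Unitaries near the identity *)

Section Unitaries.
Context (R : realType) (H : completeNormedModType R[i]) (ip : {dot H for Num.conj}).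
Hypothesis ip_norm : inner_product_norm ip.
Local Notation adj := (adj ip).
Local Notation unitary := (unitary ip).

Section OneUnitary.
Context (u : H -> H) (uU : unitary u).

Lemma unitary_linear : linear u. Proof. by case: uU => -[]. Qed.

Lemma unitaryK v : adj u (u v) = v.
Proof. by case: uU => _ + _ => /(congr1 (@^~ v)). Qed.

Lemma unitaryVK v : u (adj u v) = v.
Proof. by case: uU => _ _ /(congr1 (@^~ v)). Qed.

(* Were there no adjoint, [adj u] would be the junk value [cst 0], which has a
   left inverse only on the zero space. *)
Lemma unitary_adj : is_adj ip u (adj u).
Proof.
have [[y uy]|nex] := pselect (exists y, is_adj ip u y); first by rewrite (adjE ip_norm uy).
have uE : adj u = cst 0.
  by rewrite /Defs.adj; case: xgetP => [y _ uy|//]; case: nex; exists y.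
have H0 z : z = 0 :> H by rewrite -(unitaryK z) uE.
by move=> v w; rewrite [v]H0 [u 0]H0 !ip0l.
Qed.

Lemma unitary_ip v w : ip (u v) (u w) = ip v w.
Proof. by rewrite unitary_adj unitaryK. Qed.

Lemma unitary_nr v : nr (u v) = nr v.
Proof.
by apply/eqP; rewrite -(@eqrXn2 _ 2) ?nr_ge0// !(nr_sq ip_norm) unitary_ip.
Qed.

Lemma unitary_adj_linear : linear (adj u).
Proof. exact: (is_adj_linear ip_norm unitary_adj). Qed.

Lemma unitary_adj_nr v : nr (adj u v) = nr v.
Proof. by rewrite -{2}(unitaryVK v) unitary_nr. Qed.

End OneUnitary.

(** An adjoint that is also a two-sided inverse makes [u] isometric, whence continuity. *)
Lemma unitaryP u y : linear u -> is_adj ip u y -> cancel u y -> cancel y u ->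
  unitary u /\ adj u = y.
Proof.
move=> ul uy uK yK; have ey := adjE ip_norm uy; split => //; split.
- split=> //; apply: (@linear_bounded_continuous _ _ _ 1) => // v.
  rewrite mul1r -(@ler_pXn2r _ 2) ?nnegrE ?nr_ge0//.
  by rewrite !(nr_sq ip_norm) uy uK.
- by rewrite ey; apply/funext => v /=; rewrite uK.
- by rewrite ey; apply/funext => v /=; rewrite yK.
Qed.

Lemma unitary_comp u w : unitary u -> unitary w ->
  unitary (w \o u) /\ adj (w \o u) = adj u \o adj w.
Proof.
move=> uU wU; apply: unitaryP.
- by move=> c x y /=; rewrite (unitary_linear uU) (unitary_linear wU).
- exact: is_adj_comp (unitary_adj wU) (unitary_adj uU).
- by move=> v /=; rewrite (unitaryK wU) (unitaryK uU).
- by move=> v /=; rewrite (unitaryVK uU) (unitaryVK wU).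
Qed.

Lemma unitary_id : unitary id /\ adj id = id.
Proof. by apply: unitaryP. Qed.

(** Rank-one perturbation of the identity. It is unitary when
    [c + conjc c + c * conjc c * |z|^2 = 0], and then multiplies [z] by a phase; [c = - 2 / |z|^2]
    is the ordinary reflection. *)
Definition refl (c : R[i]) (z : H) : H -> H := fun v => v + (c * ip v z) *: z.

Lemma refl_linear c z : linear (refl c z).
Proof.
move=> d u v; rewrite /refl ipDl ipZl mulrDr scalerDl !scalerDr !scalerA mulrCA.
by rewrite addrACA.
Qed.

Lemma reflK c d z : c + d + c * d * ip z z = 0 -> cancel (refl c z) (refl d z).
Proof.
move=> cd v; rewrite /refl ipDl ipZl -addrA -scalerDl.
rewrite (_ : _ + _ = (c + d + c * d * ip z z) * ip v z); last by ring.
by rewrite cd mul0r scale0r addr0.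
Qed.

Lemma refl_unitary (c : R[i]) z : c + conjc c + c * conjc c * ip z z = 0 ->
  unitary (refl c z) /\ adj (refl c z) = refl (conjc c) z.
Proof.
move=> cz; apply: unitaryP; first exact: refl_linear.
- move=> v w; rewrite /refl ipDl ipDr ipZl ipZr; congr (_ + _).
  by rewrite cjM cjK -(ipC ip z w); ring.
- exact: reflK.
- by apply: reflK; rewrite [conjc c + c]addrC [conjc c * c]mulrC.
Qed.

Lemma refl_sub c z : refl c z \- id = fun v => (c * ip v z) *: z.
Proof. by apply/funext => v /=; rewrite /refl addrAC subrr add0r. Qed.

Lemma refl_rank c z : rank_le (refl c z \- id) 1.
Proof. by rewrite refl_sub; exact: rank_le1. Qed.

Lemma refl_compact c z : compact_op (refl c z \- id).
Proof.
rewrite refl_sub; apply: (@rank_one_compact _ _ _ _ (cn c * nr z)).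
  by move=> d u v; rewrite ipDl ipZl mulrDr mulrCA.
move=> v; rewrite cnM -mulrA ler_wpM2l ?cn_ge0// mulrC.
exact: cauchy_schwarz.
Qed.

Lemma sub_id_comp (w u : H -> H) : (w \o u) \- id = ((w \- id) \o u) \+ (u \- id).
Proof. by apply/funext => v /=; rewrite addrA subrK. Qed.

(* The unitary is the product of the generalized reflection taking [- x] to
   [y], along [x + y], with the reflection in [x]. *)
Lemma near_unitary1 x y : nr x = 1 -> nr y = 1 -> nr (y - x) <= 1 ->
  exists w, [/\ unitary w, w x = y,
    forall v, ip v x = 0 -> ip v y = 0 -> w v = v,
    rank_le (w \- id) 2 /\ compact_op (w \- id) &
    forall v, nr (w v - v) <= 4 * nr (y - x) * nr v].
Proof.
move=> x1 y1 xy1.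
have xx : ip x x = 1 by rewrite (ipvv ip_norm) x1 expr1n.
have yy : ip y y = 1 by rewrite (ipvv ip_norm) y1 expr1n.
(* Here [p = <x, z>], so the coefficient [- p^-1] sends [- x] to [- x + z = y]. As [|y - x| <= 1],
   the real part of [t] is at least 1/2 and [p] stays away from 0. *)
pose t := ip x y; pose p : R[i] := 1 + t; pose z := x + y.
have Rt : 1 / 2 <= Re t.
  have := nrB_sq ip_norm y x; rewrite x1 y1 (ipC ip y x).
  have -> : Re (conjc (ip x y)) = Re t by rewrite /t; case: (ip x y).
  have := nr_ge0 (y - x); nra.
have p1 : 1 <= cn p.
  apply: le_trans (cn_Re p); apply: le_trans (ler_norm _).
  by rewrite /p raddfD/=; lra.
have p0 : p != 0 by apply/eqP => p0; move: p1; rewrite p0 cn0; lra.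
have pj0 : conjc p != 0 by rewrite cj_eq0.
have zz : ip z z = p + conjc p.
  rewrite /z ipDl !ipDr xx yy (ipC ip y x) /p cjD (cj_nat _ 1) /t.
  by rewrite [conjc _ + 1]addrC.
have [rU _] : unitary (refl (- 2) x) /\ adj (refl (- 2) x) = refl (conjc (- 2)) x.
  apply: refl_unitary; rewrite xx; have -> : conjc (- 2 : R[i]) = - 2.
    by rewrite cjN cj_nat.
  by ring.
have [sU _] : unitary (refl (- p^-1) z) /\ adj (refl (- p^-1) z) = refl (conjc (- p^-1)) z.
  apply: refl_unitary; rewrite zz.
  have -> : conjc (- p^-1) = - (conjc p)^-1 by rewrite cjN cjV.
  by field; rewrite p0 pj0.
have xzp : ip x z = p by rewrite /z ipDr xx.
exists (refl (- p^-1) z \o refl (- 2) x); split.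
- by have [] := unitary_comp rU sU.
- rewrite /= /refl xx mulr1 scaleNr scaler_nat.
  have -> : x - x *+ 2 = - x by rewrite mulr2n opprD addrA subrr add0r.
  by rewrite ipNl xzp mulrN mulNr opprK mulVf// scale1r /z addKr.
- move=> v vx vy; rewrite /= /refl vx mulr0 scale0r addr0 /z ipDr vx vy addr0.
  by rewrite mulr0 scale0r addr0.
- rewrite sub_id_comp; split.
    by apply: (@rank_leD _ _ _ _ 1 1); [apply: rank_le_compr|]; exact: refl_rank.
  apply: compact_opD; last exact: refl_compact.
  apply: (@compact_op_compr _ _ _ _ 1); first exact: refl_compact.
    exact: refl_linear.
  by move=> v; rewrite (unitary_nr rU) mul1r.
move=> v; rewrite /=.
(* The reflection in [x] is an isometric involution, so after substituting [u] for the reflected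
   vector it remains to compare the two reflections at [u]. *)
have rr : refl (- 2) x (refl (- 2) x v) = v by apply: reflK; rewrite xx; ring.
rewrite -[X in _ - X]rr -(unitary_nr rU v); move: (refl _ x v) => u {rr v}.
pose d := y - x; have zd : z = 2 *: x + d by rewrite /z /d scaler_nat mulr2n -addrA; congr (_ + _); rewrite addrC subrK.
(* For [y = x] one has [z = 2 x] and [p = 2], and the reflections coincide. The three terms isolate
   what vanishes with [d]; they contribute 2, 1 and 1 times [|d| |u|]. *)
have -> : refl (- p^-1) z u - refl (- 2) x u =
    ((2^-1 - p^-1) * ip u z) *: z - (2^-1 * ip u d) *: z - ip u x *: d.
  have zE : ip u z = 2 * ip u x + ip u d by rewrite zd ipDr ipZr cj_nat.
  rewrite -scalerBl (_ : _ - _ = ip u x - p^-1 * ip u z); last first.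
    by rewrite mulrBl {1}zE; field.
  rewrite /refl opprD addrACA subrr add0r scalerBl addrAC mulNr scaleNr addrC.
  congr (_ - _); rewrite mulNr scaleNr opprK zd scalerDr addrK scalerA.
  by rewrite mulrC.
have nz : nr z <= 2 by apply: le_trans (nrD _ _) _; rewrite x1 y1.
have cp : cn (2^-1 - p^-1) <= nr d / 2.
  have -> : 2^-1 - p^-1 = 2^-1 * p^-1 * ip x d.
    by rewrite /d ipBr xx -/t (_ : t = p - 1); [field|rewrite /p addrAC subrr add0r].
  rewrite cnM cnM !cnV (_ : cn 2 = 2); last first.
    by rewrite -[(2 : R[i])](rmorph_nat (real_complex R) 2) cn_real ger0_norm.
  have := cauchy_schwarz ip_norm x d; rewrite x1 mul1r => hd.
  have pV : (cn p)^-1 <= 1 by rewrite invf_le1// (lt_le_trans _ p1).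
  have pV0 : 0 <= (cn p)^-1 by rewrite invr_ge0 cn_ge0.
  have := cn_ge0 (ip x d); have := nr_ge0 d; nra.
apply: le_trans (nrB _ _) _.
apply: le_trans (lerD (nrB _ _) (lexx _)) _; rewrite !nrZ !cnM cnV.
rewrite (_ : cn 2 = 2); last first.
  by rewrite -[(2 : R[i])](rmorph_nat (real_complex R) 2) cn_real ger0_norm.
rewrite -/d.
have h1 : cn (ip u z) <= 2 * nr u.
  by apply: le_trans (cauchy_schwarz ip_norm _ _) _; rewrite mulrC ler_wpM2r ?nr_ge0.
have h2 := cauchy_schwarz ip_norm u d; have := cauchy_schwarz ip_norm u x; rewrite x1 mulr1 => h3.
have nd := nr_ge0 d; have nu := nr_ge0 u.
have t1 : cn (2^-1 - p^-1) * cn (ip u z) * nr z <= nr d / 2 * (2 * nr u) * 2.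
  by rewrite !ler_pM ?mulr_ge0 ?cn_ge0 ?nr_ge0.
have t2 : 2^-1 * cn (ip u d) * nr z <= 2^-1 * (nr u * nr d) * 2.
  by rewrite !ler_pM ?mulr_ge0 ?cn_ge0 ?nr_ge0.
have t3 : cn (ip u x) * nr d <= nr u * nr d by rewrite ler_wpM2r.
lra.
Qed.

(** Induction on [N]: a unitary [w] takes care of the first [N] vectors, and a second one moves
    [w (f N)] to [g N]. Each stage adds at most 2 to the rank of the difference from 1. *)
Lemma near_unitary N (d : R) : 0 < d -> exists2 r : R, 0 < r & forall f g : nat -> H,
  orthon ip N f -> orthon ip N g -> (forall i, (i < N)%N -> nr (g i - f i) < r) ->
  exists w, [/\ unitary w, forall i, (i < N)%N -> w (f i) = g i,
    rank_le (w \- id) N.*2, compact_op (w \- id) &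
    forall v, nr (w v - v) <= d * nr v].
Proof.
elim: N d => [|N IH] d d0.
  exists 1 => // f g _ _ _; exists id; split => //; first by have [] := unitary_id.
  - by apply: rank_le0 => v /=; rewrite subrr.
  - rewrite (_ : _ \- _ = fun v : H => 0 *: 0).
      apply: (@rank_one_compact _ _ (fun=> 0) _ 0) => [c u v|v].
        by rewrite mulr0 addr0.
      by rewrite cn0 mul0r.
    by apply/funext => v /=; rewrite subrr scale0r.
  - by move=> v; rewrite subrr nr0 mulr_ge0 ?nr_ge0// ltW.
(* Two errors of [m / 16] put [w (f N)] within [m / 8 <= 1] of [g N]. The new factor then costs at
   most [4 * (m / 8)], and with the old [m / 16] the total is below [m <= d]. *)
pose m := Num.min d 1; have m0 : 0 < m by rewrite /m lt_min d0 ltr01.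
have md : m <= d by rewrite /m ge_min lexx.
have m1 : m <= 1 by rewrite /m ge_min lexx orbT.
have m16 : 0 < m / 16 by rewrite divr_gt0.
have [r r0 rP] := IH (m / 16) m16.
exists (Num.min r (m / 16)); first by rewrite lt_min r0.
move=> f g onf ong fg.
have lt_N i : (i < N)%N -> (i < N.+1)%N by move=> ?; exact: ltnW.
have [||i iN|w [wU wf wr wc wd]] := rP f g.
- by move=> i j iN jN; rewrite onf ?lt_N.
- by move=> i j iN jN; rewrite ong ?lt_N.
- by have := fg i (lt_N i iN); rewrite lt_min => /andP[].
have fN1 := orthon_nr ip_norm onf (ltnSn N); have gN1 := orthon_nr ip_norm ong (ltnSn N).
have close : nr (g N - w (f N)) <= m / 8.
  have := fg N (ltnSn N); rewrite lt_min => /andP[_ h1].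
  have := wd (f N); rewrite fN1 mulr1 => h2.
  rewrite -(subrKA (f N)); apply: le_trans (nrD _ _) _.
  rewrite [nr (f N - _)]nr_distC; lra.
have [||w' [wU' wx' wfix' [wr' wc'] wd']] := @near_unitary1 (w (f N)) (g N) _ gN1.
- by rewrite (unitary_nr wU).
- by lra.
exists (w' \o w); split.
- by have [] := unitary_comp wU wU'.
- move=> i; rewrite ltnS leq_eqVlt => /predU1P[->//|iN] /=.
  (* The second unitary fixes [g i], which is orthogonal to [g N] and, being [w (f i)], also to
     [w (f N)]. *)
  rewrite wf// wfix'//; last by rewrite ong ?(lt_N i)// ltn_eqF.
  by rewrite -wf// (unitary_ip wU) onf ?(lt_N i)// ltn_eqF.
- rewrite sub_id_comp doubleS -addn2 addnC.
  by apply: rank_leD => //; exact: rank_le_compr.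
- rewrite sub_id_comp; apply: compact_opD => //.
  apply: (@compact_op_compr _ _ _ _ 1) => //; first exact: unitary_linear.
  by move=> v; rewrite (unitary_nr wU) mul1r.
- move=> v /=; rewrite -(subrKA (w v)); apply: le_trans (nrD _ _) _.
  have := wd' (w v); rewrite (unitary_nr wU) => h1; have := wd v => h2.
  have nv := nr_ge0 v.
  have : 4 * nr (g N - w (f N)) * nr v <= 4 * (m / 8) * nr v.
    by rewrite ler_wpM2r// ler_wpM2l.
  have : m * nr v <= d * nr v by rewrite ler_wpM2r.
  have : 0 <= m * nr v by rewrite mulr_ge0 ?(ltW m0).
  lra.
Qed.

End Unitaries.

(** * Topologies on the orbit *)

Section Orbit.
Context (R : realType) (H : completeNormedModType R[i]) (ip : {dot H for Num.conj}).
Hypothesis ip_norm : inner_product_norm ip.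
Hypothesis H_infinite : ~ finite_dim [set: H].
Context (Phi : R^nat -> R) (snf : symmetric_norming Phi).
Local Notation adj := (adj ip).
Local Notation unitary := (unitary ip).
Local Notation normPhi := (normPhi ip Phi).
Local Notation idealPhi := (idealPhi ip Phi).
Local Notation U := (unitaryPhi ip Phi).

(** Membership in the group as a predicate on plain operators, so that products are formed first and
    lifted to [U] afterwards. *)
Definition UI (u : H -> H) := unitary u /\ idealPhi (u \- id).

Lemma UI_val (u : U) : UI (\val u).
Proof. exact: set_mem (valP u). Qed.

Lemma UI_lift (u : H -> H) : UI u -> exists v : U, \val v = u.
Proof. by move=> hu; exists (SigSub (mem_set hu)). Qed.

Lemma UI_rank u n (c : R) : unitary u -> compact_op (u \- id) -> rank_le (u \- id) n ->
  (forall v, nr (u v - v) <= c * nr v) -> UI u.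
Proof. by move=> uU uc ur ub; split => //; exact: (ideal_rank ip_norm H_infinite snf uc ur ub). Qed.

Lemma unitary_nr_le u v : unitary u -> nr (u v) <= 1 * nr v.
Proof. by move=> uU; rewrite (unitary_nr ip_norm uU) mul1r. Qed.

Lemma unitary_adj_nr_le u v : unitary u -> nr (adj u v) <= 1 * nr v.
Proof. by move=> uU; rewrite (unitary_adj_nr ip_norm uU) mul1r. Qed.

Lemma UI_id : UI id.
Proof.
split; first by have [] := unitary_id ip_norm.
apply: (ideal_rank ip_norm H_infinite snf (n := 0) (c := 0)).
- rewrite (_ : _ \- _ = fun v : H => 0 *: 0).
    apply: (@rank_one_compact _ _ (fun=> 0) _ 0) => [c u v|v].
      by rewrite mulr0 addr0.
    by rewrite cn0 mul0r.
  by apply/funext => v /=; rewrite subrr scale0r.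
- by apply: rank_le0 => v /=; rewrite subrr.
- by move=> v /=; rewrite subrr nr0 mul0r.
Qed.

Lemma UI_comp u w : UI u -> UI w -> UI (w \o u).
Proof.
move=> [uU uI] [wU wI]; split; first by have [] := unitary_comp ip_norm uU wU.
rewrite sub_id_comp; apply: (idealD ip_norm H_infinite snf) => //.
apply: (ideal_comp ip_norm H_infinite snf (b := id) (c := u) wI (B := 1) (C := 1)) => //.
- exact: unitary_linear uU.
- by move=> v; rewrite mul1r.
- by move=> v; exact: unitary_nr_le.
Qed.

(** The inverse satisfies [adj u - 1 = adj u \o (1 - u)], which lies in the ideal. *)
Lemma UI_adj u : UI u -> UI (adj u).
Proof.
move=> [uU uI]; split.
  have [||||//] := @unitaryP _ _ _ ip_norm (adj u) u.
  - exact: unitary_adj_linear uU.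
  - by apply: is_adj_sym; exact: unitary_adj uU.
  - exact: unitaryVK uU.
  - exact: unitaryK uU.
have := ideal_comp ip_norm H_infinite snf (idealN ip_norm H_infinite snf uI)
  (unitary_adj_linear ip_norm uU) (@id_linear _ H) ler01 ler01
  (fun v => unitary_adj_nr_le v uU) (@nr_id_le _ H).
rewrite (_ : _ \o _ = adj u \- id)//; apply/funext => v /=.
by rewrite opprB (lin_sub (unitary_adj_linear ip_norm uU)) (unitaryK uU).
Qed.

Lemma UI_sub u v : UI u -> UI v -> idealPhi (u \- v).
Proof.
move=> [_ uI] [_ vI]; have := idealB ip_norm H_infinite snf uI vI.
by rewrite (_ : _ \- _ = u \- v)//; apply/funext => x /=; rewrite opprB subrKA.
Qed.

(** * Conjugation of [a] and the two families of open sets *)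

Section Conjugation.
Context (a : H -> H) (al : linear a) (A : R) (A0 : 0 <= A).
Hypothesis (aA : forall v, nr (a v) <= A * nr v).

Definition conjugate (u : H -> H) := u \o a \o adj u.
Local Notation cjo := conjugate.

(** Continuity of conjugation, from the splitting [(v - u) a v^-1 - u a v^-1 (v - u) u^-1]. Each
    term has norm at most [A * r], and the quasi-triangle inequality doubles their sum. *)
Lemma conjugate_sub u v (r : R) : UI u -> UI v -> (normPhi (v \- u)%R <= r%:E)%E ->
  idealPhi (cjo v \- cjo u) /\ (normPhi (cjo v \- cjo u)%R <= (4 * A * r)%:E)%E.
Proof.
move=> uI vI h; have [uU _] := uI; have [vU _] := vI.
have [vuc _] := UI_sub vI uI.
have vsl := unitary_adj_linear ip_norm vU; have usl := unitary_adj_linear ip_norm uU.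
have ul := unitary_linear uU; have vl := unitary_linear vU.
have -> : cjo v \- cjo u = (id \o (v \- u) \o (a \o adj v)) \+
    ((fun x => - u (a (adj v x))) \o (v \- u) \o adj u).
  apply/funext => x; rewrite /cjo /= (unitaryVK uU).
  by rewrite (lin_sub vsl) (unitaryK vU) (lin_sub al) (lin_sub ul) opprB addrA subrK.
have [c1 h1] : compact_op (id \o (v \- u) \o (a \o adj v)) /\
    (normPhi (id \o (v \- u) \o (a \o adj v))%R <= (1 * A * r)%:E)%E.
  apply: (normPhi_comp ip_norm H_infinite snf) => //.
  - by move=> c x y /=; rewrite vsl al.
  - by move=> x; rewrite mul1r.
  - by move=> x /=; apply: le_trans (aA _) _; rewrite (unitary_adj_nr ip_norm vU).
have [c2 h2] : compact_op ((fun x => - u (a (adj v x))) \o (v \- u) \o adj u) /\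
    (normPhi ((fun x => - u (a (adj v x))) \o (v \- u) \o adj u)%R <= (A * 1 * r)%:E)%E.
  apply: (normPhi_comp ip_norm H_infinite snf) => //.
  - by move=> c x y; rewrite vsl al ul scalerN opprD.
  - by move=> x; rewrite nrN (unitary_nr ip_norm uU); apply: le_trans (aA _) _; rewrite (unitary_adj_nr ip_norm vU).
  - by move=> x; exact: unitary_adj_nr_le.
have h3 := normPhiD ip_norm H_infinite snf c1 c2 h1 h2.
split; last by apply: le_trans h3 _; rewrite lee_fin; lra.
split; first exact: compact_opD.
by apply/normPhi_lty; eexists; exact: h3.
Qed.

Lemma conjugate_id : cjo id = a.
Proof. by have [_ e] := unitary_id ip_norm; rewrite /cjo e. Qed.

Lemma conjugate_affine u : UI u -> idealPhi (cjo u \- a).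
Proof.
move=> uI; have := UI_sub uI UI_id; move=> /ideal_bound[r h].
by rewrite -{1}conjugate_id; have [] := conjugate_sub UI_id uI h.
Qed.

Lemma conjugate_comp u w : unitary u -> unitary w -> cjo (w \o u) = w \o cjo u \o adj w.
Proof. by move=> uU wU; have [_ e] := unitary_comp ip_norm uU wU; rewrite /cjo e. Qed.

Local Notation pi := (@orbit_pi R H ip Phi a).

Lemma pi_eq (u v : U) : cjo (\val u) = cjo (\val v) -> pi u = pi v.
Proof. by move=> e; apply: val_inj. Qed.

Lemma pi_conjugate (u v : U) : pi u = pi v -> cjo (\val u) = cjo (\val v).
Proof. by move=> /(congr1 val). Qed.

Lemma quotient_openP (W : set (unitary_orbit ip Phi a)) :
  @open (quotient_topology (unitary_orbit ip Phi a)) W <->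
  forall u : U, W (pi u) -> exists2 e : R, 0 < e &
    forall v : U, (normPhi (\val u \- \val v)%R < e%:E)%E -> W (pi v).
Proof.
have piE (u : U) : (\pi_(quotient_topology (unitary_orbit ip Phi a)) u)%qT = pi u.
  by rewrite unlock.
split=> [oW u Wu|hW].
  have [|e e0 h] := oW u; first by rewrite /= piE.
  by exists e => // v /h; rewrite /= piE.
suff : @open U (\pi_(quotient_topology (unitary_orbit ip Phi a))%qT @^-1` W) by [].
suff h : forall u : U, W (\pi_(quotient_topology (unitary_orbit ip Phi a)) u)%qT ->
    exists2 e : R, 0 < e & forall v : U, (normPhi (\val u \- \val v)%R < e%:E)%E ->
      W (\pi_(quotient_topology (unitary_orbit ip Phi a)) v)%qT by exact: h.
move=> u; rewrite piE => /hW[e e0 h]; exists e => // v /h.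
by rewrite piE.
Qed.

(* The ball condition at orbit points produces an open subset of the affine
   space because the quasi-triangle inequality of [normPhiD] suffices to show
   that an interior is open. *)
Lemma inherited_openP (W : set (unitary_orbit ip Phi a)) :
  inherited_open ip Phi a W <->
  forall u : U, W (pi u) -> exists2 e : R, 0 < e &
    forall v : U, (normPhi (cjo (\val u) \- cjo (\val v))%R < e%:E)%E -> W (pi v).
Proof.
have aff (u : U) : exists z : affine_space ip Phi a, \val z = cjo (\val u).
  have h : [set y | idealPhi (y \- a)] (cjo (\val u)) by exact: conjugate_affine (UI_val u).
  by exists (SigSub (mem_set h)).
have affI (z : affine_space ip Phi a) : idealPhi (\val z \- a) by exact: set_mem (valP z).
have sub2 x y : idealPhi (x \- a) -> idealPhi (y \- a) -> idealPhi (x \- y).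
  move=> xI yI; have := idealB ip_norm H_infinite snf xI yI.
  by rewrite (_ : _ \- _ = x \- y)//; apply/funext => z /=; rewrite opprB subrKA.
split.
  move=> [V oV ->] u [z Vz zE]; have [e e0 h] := oV z Vz.
  exists e => // v uv; have [z' z'E] := aff v.
  have zE' : \val z = cjo (\val u) by exact: zE.
  by exists z' => //; apply: h; move: uv; rewrite -zE' -z'E.
move=> hW.
exists [set z | exists2 e : R, 0 < e & forall v : U,
    (normPhi (\val z \- cjo (\val v))%R < e%:E)%E -> W (pi v)].
  (* The quasi-triangle inequality yields [2 * (e / 5 + e / 5) < e]. *)
  move=> z [e e0 h]; exists (e / 5); first by rewrite divr_gt0.
  move=> z' zz'; exists (e / 5); first by rewrite divr_gt0.
  move=> v z'v; apply: h.
  have [c1 _] := sub2 _ _ (affI z) (affI z').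
  have [c2 _] := sub2 _ _ (affI z') (conjugate_affine (UI_val v)).
  have := normPhiD ip_norm H_infinite snf c1 c2 (ltW zz') (ltW z'v).
  rewrite (_ : _ \+ _ = \val z \- cjo (\val v)); last first.
    by apply/funext => x /=; rewrite subrKA.
  by move=> h1; apply: le_lt_trans h1 _; rewrite lte_fin; lra.
apply/seteqP; split => [y Wy|y [z [e e0 h] zy]].
  have [u uy] := orbit_surj y; rewrite -uy in Wy.
  have [e e0 h] := hW u Wy; have [z zE] := aff u.
  by exists z; [exists e => // v; rewrite zE; exact: h|rewrite zE -uy].
have [u uy] := orbit_surj y; rewrite -uy; apply: h.
have -> : \val z = cjo (\val u) by rewrite zy -uy.
(* That a point is at distance 0 from itself is derived from the rank bound for the zero
   operator. *)
have zero v : (cjo (\val u) \- cjo (\val u)) v = 0 by rewrite /= subrr.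
have [c0 _] := sub2 _ _ (conjugate_affine (UI_val u)) (conjugate_affine (UI_val u)).
have := normPhi_rank ip_norm H_infinite snf (c := 0) c0 (rank_le0 zero).
by rewrite mul0r => h; apply: le_lt_trans (h _) _ => [v|]; rewrite ?lte_fin// zero nr0 mul0r.
Qed.

Lemma inherited_quotient_open (W : set (unitary_orbit ip Phi a)) :
  inherited_open ip Phi a W -> @open (quotient_topology (unitary_orbit ip Phi a)) W.
Proof.
move=> /inherited_openP hW; apply/quotient_openP => u /hW[e e0 h].
(* The constant [4 * A] of [conjugate_sub] may be 0; adding 1 allows division. *)
have A1 : 0 < 4 * A + 1 by move: A0; lra.
exists (e / (4 * A + 1)); first by rewrite divr_gt0.
move=> v /ltW uv; apply: h.
have [_ h1] := conjugate_sub (UI_val v) (UI_val u) uv.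
apply: le_lt_trans h1 _; rewrite lte_fin mulrA ltr_pdivrMr//; nra.
Qed.

End Conjugation.

End Orbit.

(** * Finite rank: quotient-open sets are inherited *)

Section Topologies.
Context (R : realType) (H : completeNormedModType R[i]) (ip : {dot H for Num.conj}).
Hypothesis ip_norm : inner_product_norm ip.
Hypothesis H_infinite : ~ finite_dim [set: H].
Context (Phi : R^nat -> R) (snf : symmetric_norming Phi).
Local Notation adj := (adj ip).
Local Notation unitary := (unitary ip).
Local Notation normPhi := (normPhi ip Phi).
Local Notation idealPhi := (idealPhi ip Phi).
Local Notation U := (unitaryPhi ip Phi).
Local Notation UI := (UI ip Phi).
Context (a : H -> H) (ac : compact_op a) (an : normal_op ip a).
Local Notation cjo := (conjugate ip a).
Local Notation pi := (@orbit_pi R H ip Phi a).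

Let al : linear a. Proof. by case: ac. Qed.
Let aadj : is_adj ip a (adj a). Proof. exact: compact_adj. Qed.

Lemma normal_nr v : nr (a v) = nr (adj a v).
Proof.
apply/eqP; rewrite -(@eqrXn2 _ 2) ?nr_ge0// !(nr_sq ip_norm); apply/eqP.
have [_ /(congr1 (@^~ v))/= e] := an.
by rewrite aadj e -(is_adj_sym aadj).
Qed.

(** Orthonormal families in the range of [a] have bounded size, so some family of size [N] exists
    while none of size [N + 1] does. A nonzero residual of [a v] could be normalized and appended,
    so all residuals vanish. The preimages [d] serve the clustering argument. *)
Lemma finite_rank_basis : finite_rank a ->
  exists N (e d : nat -> H), [/\ orthon ip N e, forall i, (i < N)%N -> e i = a (d i) &
    forall v, a v = proj ip N e (a v)].
Proof.
move=> [m [f fP]].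
pose P n := exists e d : nat -> H, orthon ip n e /\ forall i, (i < n)%N -> e i = a (d i).
have nP : ~ P m.+1.
  move=> [e [d [on ed]]].
  have ef (i : 'I_m.+1) : exists c : 'I_m -> R[i], e i = \sum_j c j *: f j.
    by apply: fP; rewrite ed//; exists (d i).
  have [c [i ci] c0] := span_dependent (ltnSn m) ef.
  by move: ci; rewrite (orthon_free on c0) eqxx.
have [N [[e [d [on ed]]] nPS]] : exists N, P N /\ ~ P N.+1.
  apply: contrapT => h; apply: nP.
  have : forall n, P n by elim=> [|n IH]; [exists (fun=> 0), (fun=> 0)|apply: contrapT => ?; apply: h; exists n].
  exact.
exists N, e, d; split => // v; apply/eqP; rewrite -subr_eq0; apply/eqP; apply: contrapT => r0.
apply: nPS; set r := a v - _ in r0.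
pose k : R[i] := (nr r)^-1%:C.
pose w := v - \sum_(i < N) ip (a v) (e i) *: d i.
have rE : r = a w.
  rewrite /w (lin_sub al) (lin_sum al); congr (_ - _); apply: eq_bigr => i _.
  by rewrite (lin_scale al) ed.
exists (fun i => if i == N then k *: r else e i), (fun i => if i == N then k *: w else d i).
split; last first.
  move=> i; rewrite ltnS leq_eqVlt => /predU1P[->|iN]; first by rewrite eqxx rE (lin_scale al).
  by rewrite ltn_eqF// ed.
have on' : orthon ip N (fun i => if i == N then k *: r else e i).
  by move=> i j iN jN; rewrite (ltn_eqF iN) (ltn_eqF jN) on.
apply: orthonS => //; rewrite eqxx; last exact: normalize.
by move=> i iN; rewrite ltn_eqF// ipZl perp_proj// mulr0.
Qed.

(** Agreement on the range gives [u a = v a], and on adjoints [adj a \o adj u = adj a \o adj v].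
    Normality, through equality of the kernels of [a] and [adj a], turns this into
    [a \o adj u = a \o adj v]. *)
Lemma conjugate_agree N e (u v : H -> H) : (forall x, a x = proj ip N e (a x)) ->
  unitary u -> unitary v -> (forall i, (i < N)%N -> u (e i) = v (e i)) -> cjo u = cjo v.
Proof.
move=> ae uU vU uv; have uva x : u (a x) = v (a x).
  rewrite ae /proj (lin_sum (unitary_linear uU)) (lin_sum (unitary_linear vU)).
  by apply: eq_bigr => i _; rewrite (lin_scale (unitary_linear uU)) (lin_scale (unitary_linear vU)) uv.
apply/funext => x; rewrite /conjugate /= uva; congr (v _).
apply/eqP; rewrite -subr_eq0 -(lin_sub al); apply/eqP/nr_eq0; rewrite normal_nr.
set r := _ - _; suff -> : adj a r = 0 by rewrite nr0.
apply: (ip_inj ip_norm) => y; rewrite ip0r -aadj /r ipBr.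
by rewrite -(unitary_adj ip_norm uU) -(unitary_adj ip_norm vU) uva subrr.
Qed.

Lemma conjugate_linear u : unitary u -> linear (cjo u).
Proof.
move=> uU c x y; rewrite /conjugate /= (unitary_adj_linear ip_norm uU) al.
by rewrite (unitary_linear uU).
Qed.

Lemma conjugate_compact u : unitary u -> compact_op (cjo u).
Proof.
move=> uU; apply: (@compact_op_compr _ _ _ _ 1).
- apply: (@compact_op_compl _ _ _ _ 1) => //; first exact: unitary_linear uU.
  by move=> v; exact: unitary_nr_le.
- exact: unitary_adj_linear uU.
- by move=> v; exact: unitary_adj_nr_le.
Qed.

Lemma conjugate_bound u (A : R) : unitary u -> (forall v, nr (a v) <= A * nr v) ->
  forall v, nr (cjo u v) <= A * nr v.
Proof.
move=> uU aA v; rewrite /conjugate /= (unitary_nr ip_norm uU).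
by apply: le_trans (aA _) _; rewrite (unitary_adj_nr ip_norm uU).
Qed.

(* Vectors [v_k e_i = (v_k a v_k^-1) (v_k d_i)] are almost images of bounded
   vectors under the fixed compact operator [cjo u], hence cluster. *)
Lemma frame_cluster N (e d : nat -> H) (u : H -> H) (v : nat -> H -> H) :
  (forall i, (i < N)%N -> e i = a (d i)) -> unitary u -> (forall k, unitary (v k)) ->
  (forall k x, nr (cjo u x - cjo (v k) x) <= k.+1%:R^-1 * nr x) ->
  exists g : nat -> H, forall eps : R, 0 < eps -> exists2 k, k.+1%:R^-1 < eps &
    forall i, (i < N)%N -> nr (v k (e i) - g i) < eps.
Proof.
move=> ed uU vU uv.
pose C := \sum_(i < N) nr (d i) + 1.
have C1 : 1 <= C by rewrite lerDr sumr_ge0// => i _; rewrite nr_ge0.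
have dC i : (i < N)%N -> nr (d i) <= C.
  move=> iN; rewrite /C (bigD1 (Ordinal iN))//= -addrA lerDl addr_ge0//.
  by rewrite sumr_ge0// => j _; rewrite nr_ge0.
have C0 : 0 < C by lra.
have [|g gP] := compact_cluster (N := N) (f := fun i k => v k (d i)) (conjugate_compact uU) C0.
  by move=> i k iN; rewrite (unitary_nr ip_norm (vU k)) dC.
exists g => eps eps0; have eC : 0 < eps / (2 * C) by rewrite divr_gt0// mulr_gt0.
have [n nP] := invS_small eC.
have [|k nk gk] := gP n (eps / 2); first by rewrite divr_gt0.
have kC := nP _ nk.
exists k.
  apply: lt_le_trans kC _; rewrite ler_pdivrMr ?mulr_gt0//; nra.
move=> i iN; have := gk i iN; have := uv k (v k (d i)).
have -> : cjo (v k) (v k (d i)) = v k (e i).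
  by rewrite /conjugate /= (unitaryK (vU k)) ed.
rewrite (unitary_nr ip_norm (vU k)) => h1 h2.
rewrite -(subrKA (cjo u (v k (d i)))); apply: le_lt_trans (nrD _ _) _.
rewrite nr_distC.
have : k.+1%:R^-1 * nr (d i) <= eps / 2.
  have -> : eps / 2 = eps / (2 * C) * C by field; rewrite gt_eqF.
  by rewrite ler_pM ?nr_ge0 ?dC ?invr_ge0// ltW.
move: h1 h2; move: (k.+1%:R^-1 * nr (d i)) => q; lra.
Qed.

Lemma frame_limit_orthon N (e g : nat -> H) (v : nat -> H -> H) :
  orthon ip N e -> (forall k, unitary (v k)) ->
  (forall eps : R, 0 < eps -> exists2 k, k.+1%:R^-1 < eps &
    forall i, (i < N)%N -> nr (v k (e i) - g i) < eps) ->
  orthon ip N g.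
Proof.
move=> on vU gP i j iN jN; apply/eqP; rewrite -subr_eq0; apply/eqP.
apply: (@cn_small_eq0 _ _ (nr (g i) + 1)) => eps /gP[k _ h].
have -> : (i == j)%:R = ip (v k (e i)) (v k (e j)) by rewrite (unitary_ip ip_norm (vU k)) on.
have -> : ip (g i) (g j) - ip (v k (e i)) (v k (e j)) =
    ip (g i) (g j - v k (e j)) + ip (g i - v k (e i)) (v k (e j)).
  by rewrite ipBl ipBr addrA subrK.
apply: le_trans (cnD _ _) _; rewrite mulrDl mul1r; apply: lerD.
  apply: le_trans (cauchy_schwarz ip_norm _ _) _; rewrite ler_wpM2l ?nr_ge0//.
  by rewrite nr_distC ltW// h.
apply: le_trans (cauchy_schwarz ip_norm _ _) _.
rewrite (unitary_nr ip_norm (vU k)) (orthon_nr ip_norm on jN) mulr1.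
by rewrite nr_distC ltW// h.
Qed.

Lemma finite_rank_inherited (W : set (unitary_orbit ip Phi a)) : finite_rank a ->
  @open (quotient_topology (unitary_orbit ip Phi a)) W -> inherited_open ip Phi a W.
Proof.
move=> afr /quotient_openP oW; have [A A0 aA] := compact_op_bound ac.
have [N [e [d [on ed ae]]]] := finite_rank_basis afr.
apply/(inherited_openP ip_norm H_infinite snf al A0 aA) => u Wu; apply: contrapT => nope.
have [uU uI] := UI_val u.
have /choice[V VP] : forall k : nat, exists v : U,
    (normPhi (cjo (\val u) \- cjo (\val v))%R < (k.+1%:R^-1)%:E)%E /\ ~ W (pi v).
  move=> k; apply: contrapT => h; apply: nope; exists k.+1%:R^-1; first by rewrite invr_gt0.
  by move=> v uv; apply: contrapT => Wv; apply: h; exists v.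
pose v k := \val (V k); have vUI k : UI (v k) by exact: UI_val.
have vU k : unitary (v k) by have [] := vUI k.
have close k x : nr (cjo (\val u) x - cjo (v k) x) <= k.+1%:R^-1 * nr x.
  have [h _] := VP k; have cc : compact_op (cjo (\val u) \- cjo (v k)).
    apply: compact_opD; first exact: conjugate_compact.
    apply: (@compact_op_compl _ _ (fun z => - z) _ 1); first exact: conjugate_compact.
      exact: opp_linear.
    by move=> z; rewrite nrN mul1r.
  exact: (normPhi_bound ip_norm H_infinite snf cc (ltW h)).
have [g gP] := frame_cluster ed uU vU close.
have ong := frame_limit_orthon on vU gP.
have onv k : orthon ip N (fun i => v k (e i)).
  by move=> i j iN jN; rewrite (unitary_ip ip_norm (vU k)) on.
(* A single [v k1] whose frame is close enough to [g] is corrected to a unitary [u1] with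
   [u1 (e i) = g i] exactly. *)
have [r1 r10 r1P] := near_unitary ip_norm N ltr01.
have [k1 _ k1P] := gP r1 r10.
have [||i iN|w1 [w1U w1g w1r w1c w1d]] := r1P (fun i => v k1 (e i)) g => //.
  by rewrite nr_distC k1P.
pose u1 := w1 \o v k1.
have u1I : UI u1.
  exact: (UI_comp ip_norm H_infinite snf (vUI k1) (UI_rank ip_norm H_infinite snf w1U w1c w1r w1d)).
have [u1U _] := u1I.
have u1e i : (i < N)%N -> u1 (e i) = g i by move=> iN; rewrite /u1 /= w1g.
(* For suitable [k], a unitary near 1 takes the frame [g] to that of [v k]; conjugation by [w \o u1]
   and by [v k] then agree because the frames do. *)
have approx (eps : R) : 0 < eps -> exists k w, [/\ UI w,
    (normPhi (w \- id)%R <= (N.*2%:R * eps)%:E)%E, forall x, nr (w x - x) <= eps * nr x,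
    cjo (w \o u1) = cjo (v k) & k.+1%:R^-1 < eps].
  move=> eps0; have [r r0 rP] := near_unitary ip_norm N eps0.
  have [|k kr kP] := gP (Num.min r eps); first by rewrite lt_min r0.
  have [||i iN|w [wU wg wr wc wd]] := rP g (fun i => v k (e i)) => //.
    by have := kP i iN; rewrite lt_min => /andP[].
  exists k, w; split => //.
  - exact: (UI_rank ip_norm H_infinite snf wU wc wr wd).
  - exact: (normPhi_rank ip_norm H_infinite snf wc wr wd).
  - apply: (conjugate_agree ae) => //; first by have [] := unitary_comp ip_norm u1U wU.
    by move=> i iN; rewrite /= u1e// wg.
  - by move: kr; rewrite lt_min => /andP[].
(* Conjugation by [w] moves [cjo u1] by at most [2 * A * eps] in operator norm, and [cjo (v k)] is
   within [eps] of [cjo u]; letting [eps] tend to 0 gives equality. *)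
have u1u : cjo u1 = cjo (\val u).
  apply/funext => x; apply/eqP; rewrite -subr_eq0; apply/eqP/nr_eq0.
  apply: (@small_eq0 _ _ ((2 * A + 1) * nr x)) => eps eps0.
  rewrite ger0_norm ?nr_ge0//.
  have [k [w [[wU _] _ wd wv keps]]] := approx eps eps0.
  have e1 : cjo (v k) x = w (cjo u1 (adj w x)) by rewrite -wv (conjugate_comp ip_norm).
  have t1 : nr (cjo (v k) x - cjo u1 (adj w x)) <= eps * (A * nr x).
    rewrite e1; apply: le_trans (wd _) _; apply: ler_wpM2l; first exact: ltW.
    by apply: le_trans (conjugate_bound u1U aA _) _; rewrite (unitary_adj_nr ip_norm wU).
  have t2 : nr (cjo u1 (adj w x) - cjo u1 x) <= A * (eps * nr x).
    rewrite -(lin_sub (conjugate_linear u1U)); apply: le_trans (conjugate_bound u1U aA _) _.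
    rewrite ler_wpM2l// -(unitary_nr ip_norm wU) (lin_sub (unitary_linear wU)) (unitaryVK wU).
    by rewrite nr_distC.
  have t3 : nr (cjo (\val u) x - cjo (v k) x) <= eps * nr x.
    by apply: le_trans (close k x) _; rewrite ler_wpM2r ?nr_ge0// ltW.
  rewrite nr_distC -(subrKA (cjo (v k) x)); apply: le_trans (nrD _ _) _.
  rewrite -(subrKA (cjo u1 (adj w x)) (cjo (v k) x)).
  apply: le_trans (lerD (lexx _) (nrD _ _)) _; lra.
have [u1' u1'E] := UI_lift u1I.
have Wu1 : W (pi u1') by rewrite (_ : pi u1' = pi u)//; apply: pi_eq; rewrite u1'E.
(* Openness is used at the representative [u1] of the same orbit point. The nearby [w \o u1]
   represents the same point as [V k], contradicting the choice of [V k] outside [W]. *)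
have [e0 e00 e0P] := oW u1' Wu1.
have N1 : 0 < N.*2%:R + 1 :> R by rewrite ltr_wpDl.
have [|k [w [wI wn _ wv _]]] := approx (e0 / (N.*2%:R + 1)); first by rewrite divr_gt0.
have wu1I := UI_comp ip_norm H_infinite snf u1I wI.
have [w' w'E] := UI_lift wu1I.
have [_ nWv] := VP k; apply: nWv.
rewrite (_ : pi (V k) = pi w'); last by apply: pi_eq; rewrite w'E wv.
apply: e0P; rewrite u1'E w'E.
have [wc _] := UI_sub ip_norm H_infinite snf wI (UI_id ip_norm H_infinite snf).
have [_] := normPhi_comp ip_norm H_infinite snf wc (@opp_linear _ H) (unitary_linear u1U)
  ler01 ler01 (@nr_opp_le _ H) (fun x => unitary_nr_le ip_norm x u1U) wn.
rewrite (_ : _ \o u1 = u1 \- (w \o u1)); last by apply/funext => x /=; rewrite opprB.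
move=> h; apply: le_lt_trans h _; rewrite lte_fin !mul1r mulrA ltr_pdivrMr//.
by rewrite [ltLHS]mulrC ltr_pM2l// ltrDl.
Qed.

End Topologies.

(** * Infinite rank: a quotient-open set that is not inherited *)

Section Converse.
Context (R : realType) (H : completeNormedModType R[i]) (ip : {dot H for Num.conj}).
Hypothesis ip_norm : inner_product_norm ip.
Hypothesis H_infinite : ~ finite_dim [set: H].
Context (Phi : R^nat -> R) (snf : symmetric_norming Phi).
Local Notation adj := (adj ip).
Local Notation unitary := (unitary ip).
Local Notation normPhi := (normPhi ip Phi).
Local Notation U := (unitaryPhi ip Phi).
Local Notation UI := (UI ip Phi).
Context (a : H -> H) (ac : compact_op a) (an : normal_op ip a).
Local Notation cjo := (conjugate ip a).
Local Notation pi := (@orbit_pi R H ip Phi a).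

Let al : linear a. Proof. by case: ac. Qed.
Let aadj : is_adj ip a (adj a). Proof. exact: compact_adj. Qed.

(** If [s n = 0], then [a] vanishes on the complement of the first [n] vectors [e i], and their
    images span its range. *)
Lemma infinite_rank_sys_gt0 e s : singular_system ip a e s -> ~ finite_rank a ->
  forall n, 0 < s n.
Proof.
move=> sys inf n; rewrite lt_def (sys_ge0 sys) andbT; apply/eqP => sn0; apply: inf.
have [on _ _ smax] := sys.
exists n, (fun i => a (e i)) => _ [v _ <-]; exists (fun i => ip v (e i)).
have /eqP : nr (a (v - proj ip n e v)) = 0.
  have := smax n _ (perp_proj v (on n)); rewrite sn0 mul0r => h.
  by apply/eqP; rewrite eq_le h nr_ge0.
move=> /eqP/nr_eq0; rewrite (lin_sub al) => /eqP; rewrite subr_eq0 => /eqP ->.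
by rewrite /proj (lin_sum al); apply: eq_bigr => i _; rewrite (lin_scale al).
Qed.

(* The orbit points reached by a unitary at operator-norm distance less than 1
   from the identity. *)
Definition near_orbit : set (unitary_orbit ip Phi a) :=
  [set y | exists w : U, pi w = y /\
     exists2 c : R, c < 1 & forall x, nr (\val w x - x) <= c * nr x].

(** If [w] is a witness at [u], then [v u^-1 w] is one at [v]: it conjugates [a] to [v a v^-1], and
    its distance from 1 is at most [|v - u| + |w - 1|], below 1 for the chosen radius. *)
Lemma near_orbit_open : @open (quotient_topology (unitary_orbit ip Phi a)) near_orbit.
Proof.
apply/quotient_openP => u [w [wu [c c1 wc]]].
exists ((1 - c) / 2); first by rewrite divr_gt0// subr_gt0.
move=> v uv; have [uI vI wI] := And3 (UI_val u) (UI_val v) (UI_val w).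
have [[uU _] [vU _] [wU _]] := And3 uI vI wI.
have [uvc _] := UI_sub ip_norm H_infinite snf uI vI.
have uvB := normPhi_bound ip_norm H_infinite snf uvc (ltW uv).
have usI := UI_adj ip_norm H_infinite snf uI.
have uwI := UI_comp ip_norm H_infinite snf wI usI.
have [w' w'E] := UI_lift (UI_comp ip_norm H_infinite snf uwI vI).
have [uwU _] := uwI; have [usU _] := usI.
exists w'; split.
  apply: pi_eq; rewrite w'E (conjugate_comp ip_norm)// (conjugate_comp ip_norm)//.
  rewrite (pi_conjugate wu).
  have -> : adj (adj (\val u)) = \val u.
    exact: (adjE ip_norm (is_adj_sym (unitary_adj ip_norm uU))).
  by apply/funext => x; rewrite /conjugate /= !(unitaryK uU).
exists ((1 - c) / 2 + c) => [|x]; first by lra.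
rewrite w'E /= -(subrKA (\val w x)); apply: le_trans (nrD _ _) _.
rewrite mulrDl; apply: lerD => //.
have := uvB (adj (\val u) (\val w x)); rewrite /= (unitaryVK uU) nr_distC.
by rewrite (unitary_adj_nr ip_norm uU) (unitary_nr ip_norm wU).
Qed.

Section Swap.
Context (e : nat -> H) (s : nat -> R) (sys : singular_system ip a e s).
Context (n m : nat) (nm : s m < s n).
Let z := e n - e m.
(** Since [<z, z> = 2], the coefficient [- 1] gives the ordinary reflection, which exchanges [e n]
    and [e m]. *)
Let u := refl ip (- 1) z.

Let nm_neq : n != m.
Proof. by apply: contraTneq nm => ->; rewrite ltxx. Qed.

Let ipe i j : ip (e i) (e j) = (i == j)%:R.
Proof.
have [on _ _ _] := sys.
by rewrite (on (maxn i j).+1)// ltnS ?leq_maxl ?leq_maxr.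
Qed.

Let nre i : nr (e i) = 1.
Proof. by have [on _ _ _] := sys; apply: (orthon_nr ip_norm (on i.+1)). Qed.

Let zz : ip z z = 2.
Proof.
by rewrite ipBl !ipBr !ipe !eqxx [m == n]eq_sym (negPf nm_neq) subr0 sub0r opprK.
Qed.

Let uUadj : unitary u /\ adj u = u.
Proof.
have cj1 : conjc (- 1 : R[i]) = - 1 by rewrite cjN (cj_nat _ 1).
have [|uU ua] := @refl_unitary _ _ _ ip_norm (- 1) z; first by rewrite cj1 zz; ring.
by split => //; rewrite ua cj1.
Qed.

Let uE v : u v = v - ip v z *: z.
Proof. by rewrite /u /refl mulN1r scaleNr. Qed.

Let uen : u (e n) = e m.
Proof. by rewrite uE ipBr !ipe eqxx (negPf nm_neq) subr0 scale1r /z subKr. Qed.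

Let uem : u (e m) = e n.
Proof.
rewrite uE ipBr !ipe eqxx [m == n]eq_sym (negPf nm_neq) sub0r scaleN1r opprK.
by rewrite /z addrC subrK.
Qed.

Lemma swap_UI : UI u.
Proof.
apply: (UI_rank ip_norm H_infinite snf (proj1 uUadj) (refl_compact ip_norm _ _) (refl_rank _ _ _)
  (c := nr z * nr z)) => v.
rewrite uE addrAC subrr add0r nrN nrZ mulrAC ler_wpM2r ?nr_ge0// mulrC.
exact: cauchy_schwarz.
Qed.

(** The difference has rank at most 2. Both [|a z|] and, by normality, [|adj a z|] are at most
    [2 * s n], which bounds the operator norm by [24 * s n]; the rank doubles the constant. *)
Lemma swap_norm : (normPhi (a \- cjo u)%R <= (48 * s n)%:E)%E.
Proof.
have [_ ua] := uUadj; have [_ sE _ _] := sys.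
have [Dc _] : compact_op (a \- cjo u) /\ True.
  have [B B0 aB] := compact_op_bound ac.
  have [h _] := idealN ip_norm H_infinite snf (conjugate_affine ip_norm H_infinite snf al B0 aB swap_UI).
  by split => //; rewrite (_ : a \- _ = fun v => - (cjo u \- a) v)//; apply/funext => v /=; rewrite opprB.
have DE v : (a \- cjo u) v = ip v z *: a z + (ip (a v) z - ip v z * ip (a z) z) *: z.
  by rewrite /conjugate /= ua !uE (lin_sub al) (lin_scale al) ipBl ipZl opprB addrCA subKr addrC.
have Dr : rank_le (a \- cjo u) 2.
  rewrite (_ : _ \- _ = (fun v => ip v z *: a z) \+
    (fun v => (ip (a v) z - ip v z * ip (a z) z) *: z)); last by apply/funext => v; exact: DE.
  by apply: (@rank_leD _ _ _ _ 1 1); exact: rank_le1.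
have nz : nr z <= 2 by apply: le_trans (nrB _ _) _; rewrite !nre.
have naz : nr (a z) <= 2 * s n.
  by rewrite /z (lin_sub al); apply: le_trans (nrB _ _) _; rewrite -!sE; move: nm; lra.
suff DB v : nr ((a \- cjo u) v) <= 24 * s n * nr v.
  apply: le_trans (normPhi_rank ip_norm H_infinite snf Dc Dr DB) _.
  by rewrite lee_fin; lra.
rewrite DE; apply: le_trans (nrD _ _) _; rewrite !nrZ.
have sn0 := sys_ge0 sys n.
have nv := nr_ge0 v.
have h1 : cn (ip v z) <= nr v * 2 by apply: le_trans (cauchy_schwarz ip_norm _ _) _; rewrite ler_wpM2l.
have h2 : cn (ip (a v) z) <= nr v * (2 * s n).
  rewrite aadj; apply: le_trans (cauchy_schwarz ip_norm _ _) _; rewrite -(normal_nr ip_norm ac an).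
  by rewrite ler_wpM2l.
have h3 : cn (ip (a z) z) <= 2 * s n * 2.
  by apply: le_trans (cauchy_schwarz ip_norm _ _) _; rewrite ler_pM ?nr_ge0.
have h4 : cn (ip v z) * cn (ip (a z) z) <= nr v * 2 * (2 * s n * 2).
  by rewrite ler_pM ?cn_ge0.
have h5 : cn (ip (a v) z - ip v z * ip (a z) z) <= 10 * s n * nr v.
  by apply: le_trans (cnD _ _) _; rewrite cnN cnM; lra.
have h6 : cn (ip v z) * nr (a z) <= nr v * 2 * (2 * s n) by rewrite ler_pM ?cn_ge0 ?nr_ge0.
have h7 : cn (ip (a v) z - ip v z * ip (a z) z) * nr z <= 10 * s n * nr v * 2.
  by rewrite ler_pM ?cn_ge0 ?nr_ge0.
lra.
Qed.

(* Since [w] and the swap carry [a] to the same operator, [w^-1 (e m)] lies in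
   the eigenspace of [a^* a] for [s n ^+ 2] and so is orthogonal to [e m]. *)
Lemma swap_far w (c : R) : unitary w -> cjo w = cjo u -> c < 1 ->
  ~ (forall x, nr (w x - x) <= c * nr x).
Proof.
move=> wU wu c1 wc; have [uU ua] := uUadj; have [_ _ sT _] := sys.
have adjc x : unitary x -> is_adj ip (cjo x) (x \o adj a \o adj x).
  move=> xU v w'; rewrite /conjugate /=.
  by rewrite (unitary_adj ip_norm xU) aadj (is_adj_sym (unitary_adj ip_norm xU)).
(* Taking adjoints lets [adj a \o a] be compared under the two conjugations. *)
have wua : w \o adj a \o adj w = u \o adj a \o adj u.
  by apply: (is_adj_unique ip_norm (adjc w wU)); rewrite wu; exact: adjc.
pose x := adj w (e m).
have xT : adj a (a x) = (s n ^+ 2)%:C *: x.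
  rewrite -[LHS](unitaryK wU) /x -(lin_scale (unitary_adj_linear ip_norm wU)); congr (adj w _).
  have := congr1 (fun f => f (cjo w (e m))) wua; rewrite {2}wu /conjugate /=.
  by rewrite (unitaryK wU) (unitaryK uU) ua uem sT (lin_scale (unitary_linear uU)) uen.
have xem : ip x (e m) = 0.
  apply: (sys_eigen_coord ip_norm ac sys xT (sys_ge0 sys n)).
  by rewrite lt_eqF.
have x1 : nr x = 1 by rewrite /x (unitary_adj_nr ip_norm wU) nre.
have := wc x; rewrite x1 mulr1 {1}/x (unitaryVK wU) => h.
(* The orthonormal vectors [e m] and [x] are at squared distance 2, while [c < 1] would make it less
   than 1. *)
have := nrB_sq ip_norm (e m) x; rewrite (ip_eq0C xem) nre x1 /= mulr0.
have := nr_ge0 (e m - x); nra.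
Qed.

End Swap.

(** The point [a] belongs to [near_orbit] with witness 1, while swaps yield orbit points outside it
    arbitrarily close to [a]. *)
Lemma near_orbit_not_inherited : ~ finite_rank a -> ~ inherited_open ip Phi a near_orbit.
Proof.
move=> inf; have [A A0 aA] := compact_op_bound ac.
move=> /(inherited_openP ip_norm H_infinite snf al A0 aA) h.
have [id' id'E] := UI_lift (UI_id ip_norm H_infinite snf).
have [|d d0 dP] := h id'.
  exists id'; split => //; exists 0 => [|x]; first exact: ltr01.
  by rewrite id'E subrr nr0 mul0r.
have [e sys] := sv_system ip_norm H_infinite ac.
have spos := infinite_rank_sys_gt0 sys inf.
(* The factor 48 is that of [swap_norm]. Positivity of [s n] then provides an index [m] with a
   strictly smaller value. *)
have [n nd] := sys_to0 ip_norm ac sys (d := d / 48) ltac:(by rewrite divr_gt0).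
have [m nm] := sys_to0 ip_norm ac sys (spos n).
have [u uE] := UI_lift (swap_UI sys nm).
have [|w [wu [c c1 wc]]] := dP u.
  rewrite id'E uE (conjugate_id ip_norm); apply: le_lt_trans (swap_norm sys nm) _.
  by rewrite lte_fin; lra.
have [wU _] := UI_val w.
apply: (swap_far sys nm wU _ c1 wc).
by rewrite (pi_conjugate wu) uE.
Qed.

End Converse.

Theorem theorem6p2 (R : realType) (H : completeNormedModType R[i])
    (ip : {dot H for Num.conj}) (ip_norm : inner_product_norm ip)
    (H_separable : separable_space H) (H_infinite : ~ finite_dim [set: H])
    (Phi : R^nat -> R) (Phi_snf : symmetric_norming Phi)
    (a : H -> H) (a_compact : compact_op a) (a_normal : normal_op ip a) :
  @open (quotient_topology (unitary_orbit ip Phi a)) = inherited_open ip Phi a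
  <-> finite_rank a.
Proof.
have [A A0 aA] := compact_op_bound a_compact; have al := proj1 a_compact.
split=> [coincide|a_fin].
  apply: contrapT => /(near_orbit_not_inherited ip_norm H_infinite Phi_snf a_compact a_normal).
  by rewrite -coincide; apply; exact: near_orbit_open.
apply/seteqP; split=> W.
  exact: finite_rank_inherited.
exact: (inherited_quotient_open ip_norm H_infinite Phi_snf al A0 aA).
Qed.
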